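(* Let $d\geq 2$. There exist integers $q=q(d)$ and $k=k(d)$ such that: (i) there exists a stationary $1$-dependent $q$-coloring of $\mathbb{Z}^d$; (ii) there exists a stationary $k$-dependent $4$-coloring of $\mathbb{Z}^d$.
   Context: $\mathbb{Z}^d$ denotes the hypercubic lattice: the graph with vertex set $\mathbb{Z}^d$ and an edge between $u$ and $v$ whenever $\|u-v\|_1=1$. For a graph $G=(V,E)$, a stochastic process $X=(X_v)_{v\in V}$ is a $q$-coloring if each $X_v$ takes values in $\{1,\ldots,q\}$ and almost surely $X_u\neq X_v$ whenever $u$ and $v$ are neighbors. It is $k$-dependent if its restrictions to two subsets of $V$ are independent whenever the subsets are at graph-distance greater than $k$ from each other. A process on $\mathbb{Z}^d$ is stationary if it is invariant in law under all translations of $\mathbb{Z}^d$. *)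

(* Defs.v *)
From HB Require Import structures.
From mathcomp Require Import all_boot all_order all_algebra.
From mathcomp Require Import all_classical all_reals all_analysis.

Set Implicit Arguments.
Unset Strict Implicit.
Unset Printing Implicit Defensive.

Import Order.TTheory GRing.Theory Num.Theory.

Local Open Scope classical_set_scope.
Local Open Scope ring_scope.

Definition l1norm (d : nat) (u : 'rV[int]_d) : int := \sum_(i < d) `|u 0 i|.

Definition lattice_adj (d : nat) : rel 'rV[int]_d :=
  fun u v => l1norm (u - v) == 1.

(* A walk from u to v is u :: p with last vertex v, and its length is size p;
   the graph distance is the least such length (infinite if there is none). *)
Definition dist_gt (V : eqType) (adj : rel V) (k : nat) (A B : set V) : Prop :=
  forall (u v : V) (p : seq V), A u -> B v ->
    path adj u p -> last u p = v -> (k < size p)%N.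

(* The sigma-algebra on T generated by the restriction to A of the family f.
   For f := fun v x => x v, on T := V -> nat, and A := setT, it is the product
   sigma-algebra. *)
Definition sigma_restr (V T : Type) (f : V -> T -> nat) (A : set V) :
    set (set T) :=
  <<s \bigcup_(v in A) preimage_set_system setT (f v) measurable >>.

Definition indep_systems (disp : measure_display) (T : measurableType disp)
    (R : realType) (P : probability T R) (F G : set (set T)) : Prop :=
  forall E1 E2 : set T, F E1 -> G E2 -> P (E1 `&` E2) = (P E1 * P E2)%E.

Definition is_coloring (V : eqType) (adj : rel V) (q : nat)
    (disp : measure_display) (T : measurableType disp) (R : realType)
    (P : probability T R) (X : V -> {RV P >-> nat}) : Prop :=
  (forall v w, (1 <= X v w <= q)%N) /\
  {ae P, forall w, forall u v : V, adj u v -> X u w <> X v w}.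

Definition k_dependent (V : eqType) (adj : rel V) (k : nat)
    (disp : measure_display) (T : measurableType disp) (R : realType)
    (P : probability T R) (X : V -> {RV P >-> nat}) : Prop :=
  forall A B : set V, dist_gt adj k A B ->
    indep_systems P (sigma_restr X A) (sigma_restr X B).

Definition stationary (d : nat) (disp : measure_display)
    (T : measurableType disp) (R : realType) (P : probability T R)
    (X : 'rV[int]_d -> {RV P >-> nat}) : Prop :=
  forall (t : 'rV[int]_d) (C : set ('rV[int]_d -> nat)),
    sigma_restr (fun v x => x v) setT C ->
    P [set w | C (fun v => X (v + t) w)] = P [set w | C (fun v => X v w)].

Definition exists_stationary_dependent_coloring (R : realType)
    (d k q : nat) : Prop :=
  exists (disp : measure_display) (T : measurableType disp)
         (P : probability T R) (X : 'rV[int]_d -> {RV P >-> nat}),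
    [/\ is_coloring (@lattice_adj d) q X,
        k_dependent (@lattice_adj d) k X
      & stationary X].

(* Main.v *)
Require Import Defs.
From mathcomp Require Import all_boot all_order all_algebra.
From mathcomp Require Import all_classical all_reals all_analysis.
From mathcomp Require Import zify ring.

Set Implicit Arguments.
Unset Strict Implicit.
Unset Printing Implicit Defensive.

Import Order.TTheory GRing.Theory Num.Theory.

(** The proof has a probabilistic half, which produces colourings with many
    colours, and a deterministic half, which reduces the number of colours
    to four.

    On the line, a one-dependent 4-colouring is obtained by giving a word x of
    length n the probability B(x) / (2^n (n+1)!), where B(x), the number of
    buildings of x, counts the orders in which the letters of x can be inserted
    one after the other so that every intermediate word is proper.  An
    induction on the lengths of x and y gives
      sum_a B(x a y) = 2 C(|x| + |y| + 2, |x| + 1) B(x) B(y)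
    ([sum_buildings_mid]), which says that forgetting one letter makes the words
    on its two sides independent ([hl_prob_mid]).  Taking x or y empty, the same
    identity gives consistency and stationarity.

    Independent copies of this process are needed along all lines v + Z u
    of the lattice, for every nonzero vector u.  The joint law assigns to a
    pattern (constraints on finitely many sites) the product over the lines of
    the one-line weights.  It is realised by a process on the unit interval with
    Lebesgue measure: the words of length n label a partition of [0, 1) into
    intervals whose lengths are the prescribed probabilities, and these
    partitions refine each other ([exists_word_process]).  Independence and
    invariance under translations hold for patterns, and extend to the generated
    sigma-algebras by the pi-lambda theorem ([exists_line_process]).

    Let U be a finite list of nonzero vectors.  Writing at v the colours
    received by v on the lines v + Z u, u in U, gives a stationary process in
    which v and v + u always differ, with a range of dependence determined by U.
    For U the standard basis this is the 1-dependent colouring with 4^d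
    colours.  More generally, any translation-equivariant function of this
    process that looks at a bounded window is stationary and finitely dependent
    ([factor_coloring]).

    For four colours, U contains all nonzero vectors of sup norm at most 4 rho,
    so that nearby vertices carry distinct labels, and a local rule is applied.
    Processing the vertices in the order of their labels, one selects a maximal
    set of centres at mutual sup distance at least rho, and gives each centre a
    radius r in [rho, 2 rho) such that the box of side 2 r around it has no face
    in a common hyperplane with a face of a nearby box.  This is possible because
    only 9^d centres are near ([radius_packing]) and each excludes 2 d values.
    The boxes cover the lattice, and an edge of the lattice crosses the boundary of
    at most one box ([one_crossing]).  The colour of v consists of two
    bits: the parity of the number of boxes containing v, and the parity of the
    coordinate sum of v relative to its root, the centre of least label among
    the boxes containing v.  If an edge preserves the first bit, then it crosses
    no boundary, so both ends have the same boxes and the same root, and the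
    second bit changes ([colour_step]). *)

(** * Counting buildings of a word *)
Section Buildings.
Local Open Scope nat_scope.
Notation word := (seq 'I_4).

Definition proper_word (w : word) : bool := sorted (fun a b => a != b) w.

Fixpoint dels (w : word) : seq word :=
  if w is a :: w' then w' :: map (cons a) (dels w') else [::].

(** The number of buildings satisfies this recursion on the last letter
    inserted; the first argument is fuel, to be instantiated by the length. *)
Fixpoint buildings_rec n (w : word) : nat :=
  if n is n'.+1 then proper_word w * \sum_(w' <- dels w) buildings_rec n' w' else 1.

Definition buildings (w : word) : nat := buildings_rec (size w) w.

Lemma size_dels (w w' : word) : w' \in dels w -> (size w').+1 = size w.
Proof.
elim: w w' => [|a w IH] w' //=; rewrite inE => /orP [/eqP -> //|/mapP [v vw ->]] /=.
by rewrite (IH v vw).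
Qed.

Lemma buildingsE w : w != [::] ->
  buildings w = proper_word w * \sum_(w' <- dels w) buildings w'.
Proof.
case: w => // a w _; rewrite /buildings.
have -> : size (a :: w) = (size w).+1 by [].
rewrite [LHS]/=; congr (_ * _).
rewrite !big_seq; apply: eq_bigr => w' h.
by have := @size_dels (a :: w) w' h; rewrite /= => -[->].
Qed.

Lemma buildings0 w : ~~ proper_word w -> buildings w = 0.
Proof. by case: w => // a w h; rewrite buildingsE // (negbTE h). Qed.

Lemma dels_cat x y :
  dels (x ++ y) = map (cat^~ y) (dels x) ++ map (cat x) (dels y).
Proof.
elim: x => [|a x IH] /=; first by rewrite map_id.
by rewrite IH map_cat -!map_comp.
Qed.

Lemma proper_catl x y : ~~ proper_word x -> ~~ proper_word (x ++ y).
Proof.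
by apply: contra; case: x => [|a x] //=; rewrite /proper_word /= cat_path => /andP [].
Qed.

Lemma proper_catr x y : ~~ proper_word y -> ~~ proper_word (x ++ y).
Proof.
apply: contra; case: x => [|a x] //=; rewrite /proper_word /= cat_path => /andP [_].
by case: y => //= b y /andP [].
Qed.

Lemma proper_double x (a : 'I_4) y : ~~ proper_word (x ++ a :: a :: y).
Proof. by apply: proper_catr; rewrite /proper_word /= eqxx. Qed.

Lemma proper_mid x (a : 'I_4) y : proper_word (x ++ a :: y) =
  proper_word (rcons x a) && proper_word (a :: y).
Proof. 
by rewrite -cat_rcons /proper_word; case: x => [|b x] //=; rewrite cat_path last_rcons.
Qed.

Lemma proper_rcons2 x (b a : 'I_4) : proper_word (rcons (rcons x b) a) =
  proper_word (rcons x b) && (b != a).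
Proof. by rewrite /proper_word; case: x => [|c x] /=; rewrite ?andbT // rcons_path last_rcons. Qed.

Lemma proper_cons2 (b a : 'I_4) y : proper_word (a :: b :: y) =
  (a != b) && proper_word (b :: y).
Proof. by []. Qed.

(** Restricting the sum to the letters a that fit between x and y only loses the
    words in which the last letter of x has been deleted and a takes its
    place; these contribute the number of buildings of x y. *)
Lemma sum_dels_left x (b : 'I_4) y : proper_word (rcons x b) ->
  \sum_(a : 'I_4) (proper_word (rcons x b ++ a :: y) *
     \sum_(x' <- dels (rcons x b)) buildings (x' ++ a :: y))
   + buildings (rcons x b ++ y) =
  \sum_(x' <- dels (rcons x b)) \sum_(a : 'I_4) buildings (x' ++ a :: y).
Proof.
move=> px.
rewrite [RHS]exchange_big /= -cats1 dels_cat /= cats0.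
under [in LHS]eq_bigr => a _ do rewrite big_cat big_seq1 big_map /= mulnDr big_distrr /=.
under [in RHS]eq_bigr => a _ do rewrite big_cat big_seq1 big_map /=.
rewrite !big_split /= -addnA; congr (_ + _).
  apply: eq_bigr => a _; apply: eq_bigr => x' _.
  case: (boolP (proper_word ((x ++ [:: b]) ++ a :: y))) => h; first by rewrite mul1n.
  rewrite buildings0 ?muln0 //; move: h.
  rewrite !proper_mid !cats1 !proper_rcons2 px /= negb_and.
  case/orP => [h|h]; last by rewrite negb_and h orbT.
  by rewrite (negbTE h) andbF.
rewrite [RHS](bigD1 b) //= [in LHS](bigD1 b) //= cats1 cat_rcons.
rewrite (negbTE (proper_double _ _ _)) mul0n add0n addnC -cat_rcons; congr (_ + _).
apply: eq_bigr => a ab.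
case: (boolP (proper_word (rcons x b ++ a :: y))) => h; first by rewrite mul1n.
rewrite buildings0 ?muln0 //; move: h.
rewrite !proper_mid proper_rcons2 px eq_sym ab /= => h.
by rewrite negb_and h orbT.
Qed.

(** The mirror image of [sum_dels_left]. *)
Lemma sum_dels_right x (b : 'I_4) y : proper_word (b :: y) ->
  \sum_(a : 'I_4) (proper_word (x ++ a :: b :: y) *
     \sum_(y' <- dels (b :: y)) buildings (x ++ a :: y'))
   + buildings (x ++ b :: y) =
  \sum_(y' <- dels (b :: y)) \sum_(a : 'I_4) buildings (x ++ a :: y').
Proof.
move=> py.
rewrite [RHS]exchange_big /=.
under [in LHS]eq_bigr => a _ do rewrite big_cons big_map /= mulnDr big_distrr /=.
under [in RHS]eq_bigr => a _ do rewrite big_cons big_map /=.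
rewrite !big_split /= addnAC; congr (_ + _); last first.
  apply: eq_bigr => a _; apply: eq_bigr => y' _.
  case: (boolP (proper_word (x ++ a :: b :: y))) => h; first by rewrite mul1n.
  rewrite buildings0 ?muln0 //; move: h.
  rewrite !proper_mid !proper_cons2 py andbT negb_and.
  case/orP => [h|/negbTE -> //]; last by rewrite andbF.
  by rewrite (negbTE h).
rewrite [RHS](bigD1 b) //= [in LHS](bigD1 b) //=.
rewrite (negbTE (proper_double _ _ _)) mul0n add0n addnC; congr (_ + _).
apply: eq_bigr => a ab.
case: (boolP (proper_word (x ++ a :: b :: y))) => h; first by rewrite mul1n.
rewrite buildings0 ?muln0 //; move: h.
by rewrite !proper_mid !proper_cons2 py ab !andbT => /negbTE ->.
Qed.

(** If x y is proper then the letters next to the gap are distinct, so that each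
    nonempty side excludes exactly one of the four letters. *)
Lemma sum_proper_mid x y : proper_word x -> proper_word y ->
  \sum_(a : 'I_4) (proper_word (x ++ a :: y) * buildings (x ++ y))
  + ((x != [::]) + (y != [::])) * buildings (x ++ y) = 4 * buildings (x ++ y).
Proof.
move=> px py; case: (boolP (proper_word (x ++ y))) => pxy; last first.
  by rewrite buildings0 // !muln0 big1 // => a _; rewrite muln0.
rewrite -big_distrl /= -mulnDl; congr (_ * _).
have e a : (proper_word (x ++ a :: y) : nat) =
   ((x == [::]) || (last a x != a)) && ((y == [::]) || (a != head a y)) :> nat.
  rewrite proper_mid; congr (_ && _ : nat).
    by case/lastP: x px {pxy} => [//|x b] px; rewrite proper_rcons2 px last_rcons; case: x {px}.
  by case: y py {pxy} => [//|b y] py; rewrite proper_cons2 py andbT.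
under eq_bigr => a _ do rewrite e.
case/lastP: x px pxy {e} => [|x b] px; case: y py => [|c y] py //= pxy.
- by rewrite sum_nat_const card_ord.
- have -> : \sum_(a < 4) (a != c) = #|predC1 c|.
    by rewrite -sum1_card [RHS]big_mkcond /=; apply: eq_bigr => a _; rewrite inE; case: eqP.
  by rewrite cardC1 card_ord.
- have -> : \sum_(a < 4) (((rcons x b == [::]) || (last a (rcons x b) != a)) && true) = #|predC1 b|.
    rewrite -sum1_card [RHS]big_mkcond /=; apply: eq_bigr => a _; rewrite inE andbT last_rcons (eq_sym b).
    by rewrite -size_eq0 size_rcons /=; case: eqP.
  by rewrite cardC1 card_ord; case: x {px pxy}.
have bc : b != c by move: pxy; rewrite cat_rcons proper_mid proper_cons2 => /and3P [].
have -> : \sum_(a < 4) (((rcons x b == [::]) || (last a (rcons x b) != a)) && (a != c)) = #|[predC (pred2 b c)]|.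
  rewrite -sum1_card [RHS]big_mkcond /=; apply: eq_bigr => a _; rewrite !inE last_rcons (eq_sym b) negb_or.
  by rewrite -size_eq0 size_rcons /=; case: eqP; case: eqP.
have := cardC (pred2 b c); rewrite card2 bc card_ord.
have -> : (rcons x b != [::]) by rewrite -size_eq0 size_rcons.
by move=> /= h; rewrite addnC; exact: h.
Qed.

(** The last letter inserted lies in x, is a, or lies in y.  By
    [sum_dels_left], [sum_dels_right] and [sum_proper_mid], the net contribution
    of the letters in the gap is the constant that turns Pascal's rule into the induction
    step; with four letters, when x and y are nonempty, it is exactly zero. *)
Theorem sum_buildings_mid x y : \sum_(a : 'I_4) buildings (x ++ a :: y) =
  2 * 'C(size x + size y + 2, (size x).+1) * buildings x * buildings y.
Proof.
have [n] := ubnP (size x + size y); elim: n x y => // n IH x y ltn.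
case: (boolP (proper_word x)) => px; last first.
  rewrite (buildings0 px) muln0 mul0n big1 // => a _.
  by rewrite buildings0 // proper_catl.
case: (boolP (proper_word y)) => py; last first.
  rewrite (buildings0 py) muln0 big1 // => a _.
  by rewrite buildings0 // -cat_rcons proper_catr.
have -> : \sum_(a : 'I_4) buildings (x ++ a :: y) =
   \sum_(a : 'I_4) (proper_word (x ++ a :: y) *
     \sum_(x' <- dels x) buildings (x' ++ a :: y))
 + \sum_(a : 'I_4) (proper_word (x ++ a :: y) * buildings (x ++ y))
 + \sum_(a : 'I_4) (proper_word (x ++ a :: y) *
     \sum_(y' <- dels y) buildings (x ++ a :: y')).
  rewrite -!big_split /=; apply: eq_bigr => a _.
  rewrite buildingsE; last by case: (x).
  by rewrite dels_cat big_cat !big_map /= big_cons big_map !mulnDr addnA.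
have Sx : x != [::] -> \sum_(x' <- dels x) \sum_(a : 'I_4) buildings (x' ++ a :: y)
   = 2 * 'C(size x + size y + 1, size x) * buildings x * buildings y.
  move=> x0; rewrite (buildingsE x0) px mul1n big_distrr big_distrl /= !big_seq.
  apply: eq_bigr => x' /size_dels sx; rewrite IH; last by lia.
  rewrite sx; congr (_ * 'C(_, _) * _ * _). lia.
have Sy : y != [::] -> \sum_(y' <- dels y) \sum_(a : 'I_4) buildings (x ++ a :: y')
   = 2 * 'C(size x + size y + 1, (size x).+1) * buildings x * buildings y.
  move=> y0; rewrite (buildingsE y0) py mul1n big_distrr /= !big_seq.
  apply: eq_bigr => y' /size_dels sy; rewrite IH; last by lia.
  by congr (_ * 'C(_, _) * _ * _); lia.
have M := sum_proper_mid px py.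
have -> : size x + size y + 2 = (size x + size y + 1).+1 by lia.
rewrite binS mulnDr mulnDl mulnDl.
case/lastP: x px {ltn IH} Sx Sy M => [|x b] px; case: y py => [|c y] py.
- move=> _ _ M.
  rewrite [X in X + _ + _]big1; last by move=> a _; rewrite big_nil muln0.
  rewrite [X in _ + _ + X]big1; last by move=> a _; rewrite big_nil muln0.
  by move: M; rewrite eqxx /= mul0n addn0 => ->.
- move=> _ /(_ isT) <-; rewrite -sum_dels_right //= => M.
  rewrite [X in X + _ + _]big1; last by move=> a _; rewrite big_nil muln0.
  have -> : 2 * 'C(0 + (size y).+1 + 1, 0) * buildings [::] * buildings (c :: y) =
            2 * buildings (c :: y) by rewrite bin0 !muln1.
  by lia.
- have r0 : rcons x b != [::] by case: (x).
  move=> /(_ r0) <- _; rewrite -sum_dels_left //= r0 !cats0 => M.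
  rewrite [X in _ + _ + X]big1; last by move=> a _; rewrite big_nil muln0.
  have -> : 2 * 'C(size (rcons x b) + 0 + 1, (size (rcons x b)).+1) * buildings (rcons x b) * buildings [::] =
            2 * buildings (rcons x b) by rewrite addn0 addn1 binn !muln1.
  by lia.
have r0 : rcons x b != [::] by case: (x).
move=> /(_ r0) <- /(_ isT) <-; rewrite -sum_dels_left // -sum_dels_right //= r0 => M.
lia.
Qed.

End Buildings.

(** * The one-dependent law on words, and sums over patterns *)
Section HolroydLiggett.
Local Open Scope ring_scope.
Variable R : realFieldType.

(** The Holroyd-Liggett law of the 1-dependent 4-colouring of the line. *)
Definition hl_prob (w : seq 'I_4) : R :=
  (buildings w)%:R / (2 ^ size w * (size w).+1`!)%:R.

Lemma hl_prob_ge0 w : 0 <= hl_prob w.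
Proof. by rewrite divr_ge0. Qed.

Lemma hl_prob_nil : hl_prob [::] = 1.
Proof. by rewrite /hl_prob /= divr1. Qed.

(** One-dependence, and (for x or y empty) consistency of the law on words. *)
Lemma hl_prob_mid x y : \sum_(a : 'I_4) hl_prob (x ++ a :: y) = hl_prob x * hl_prob y.
Proof.
set m := size x; set n := size y.
have szE a : size (x ++ a :: y) = (m + n).+1 by rewrite size_cat addnS.
under eq_bigr => a _ do rewrite /hl_prob szE.
rewrite -big_distrl /= -natr_sum sum_buildings_mid /hl_prob -/m -/n.
have h := @bin_fact (m + n + 2) m.+1 ltac:(lia).
have e : (m + n + 2 - m.+1 = n.+1)%N by lia.
rewrite e in h.
have -> : (m + n).+2`! = (m + n + 2)`! by congr (_ `!); lia.
have nz k : (k`!%:R != 0 :> R) by rewrite pnatr_eq0 -lt0n fact_gt0.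
have n2 k : ((2 ^ k)%:R != 0 :> R) by rewrite pnatr_eq0 -lt0n expn_gt0.
have nC : ('C(m + n + 2, m.+1)%:R != 0 :> R) by rewrite pnatr_eq0 -lt0n bin_gt0; lia.
rewrite -h expnS expnD.
have := nz n.+1; have := nz m.+1.
move: (m.+1)`! (n.+1)`! => fm fn nzm nzn; rewrite !natrM.
by field; rewrite nzm nzn !n2 nC.
Qed.

Lemma hl_prob_double x a y : hl_prob (x ++ a :: a :: y) = 0.
Proof. by rewrite /hl_prob buildings0 ?mul0r // proper_double. Qed.

End HolroydLiggett.

Section Patterns.
Local Open Scope ring_scope.
Variables (R : realFieldType) (A : finType) (p : seq A -> R).
Hypothesis p_ge0 : forall w, 0 <= p w.
Hypothesis p_nil : p [::] = 1.
Hypothesis p_mid : forall x y, \sum_(a : A) p (x ++ a :: y) = p x * p y.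

Implicit Types (f g : nat -> pred A) (w x y : seq A).

Definition full (f : pred A) := forall a, f a.

(** The total weight of the words x ++ w such that w has length n and its i-th letter
    satisfies f i. *)
Fixpoint psum x f n : R :=
  if n is n'.+1 then
    \sum_(a : A | f 0%N a) psum (rcons x a) (fun i => f i.+1) n'
  else p x.

Lemma psum_ge0 x f n : 0 <= psum x f n.
Proof. by elim: n x f => [|n IH] x f //=; apply: sumr_ge0 => a _. Qed.

Lemma eq_psum x f g n : (forall i, (i < n)%N -> f i =1 g i) -> psum x f n = psum x g n.
Proof.
elim: n x f g => [|n IH] x f g h //=.
by apply: eq_big => [a|a _]; [exact: h|apply: IH => i ni; exact: h].
Qed.

Lemma sum_psum_mid x y f n :
  \sum_(a : A) psum (x ++ a :: y) f n = p x * psum y f n.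
Proof.
elim: n x y f => [|n IH] x y f //=.
rewrite exchange_big /= big_distrr /=; apply: eq_bigr => b _.
by rewrite -IH; apply: eq_bigr => a _; rewrite rcons_cat.
Qed.

(** An unconstrained letter decouples what precedes it from what follows it. *)
Lemma psum_renew x f n : full (f 0%N) ->
  psum x f n.+1 = p x * psum [::] (fun i => f i.+1) n.
Proof.
move=> f0 /=; rewrite -sum_psum_mid; apply: eq_big => a; first exact: f0.
by rewrite -cats1.
Qed.

Lemma psum_behead f n : full (f 0%N) ->
  psum [::] f n.+1 = psum [::] (fun i => f i.+1) n.
Proof. by move=> f0; rewrite psum_renew // p_nil mul1r. Qed.

Lemma psum_belast x f n : full (f n) -> psum x f n.+1 = psum x f n.
Proof.
elim: n x f => [|n IH] x f fn; first by rewrite psum_renew //= p_nil mulr1.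
have e g m y : psum y g m.+1 =
    \sum_(a : A | g 0%N a) psum (rcons y a) (fun i => g i.+1) m by [].
by rewrite e [RHS]e; apply: eq_bigr => a _; exact: IH.
Qed.

(** No constrained position of f is within distance one of a constrained position
    of g. *)
Definition apart f g n := forall i j, (i < n)%N -> (j < n)%N ->
  (i <= j.+1)%N -> (j <= i.+1)%N -> full (f i) \/ full (g j).

Lemma apartS f g n : apart f g n.+1 -> apart (fun i => f i.+1) (fun i => g i.+1) n.
Proof. by move=> h i j ni nj ij ji; apply: h; lia. Qed.

Lemma apartC f g n : apart f g n -> apart g f n.
Proof. by move=> h i j ni nj ij ji; apply/or_comm; exact: h. Qed.

(** Independence of two patterns whose constrained positions may interleave.  Runs of
    positions constrained by f are separated from those constrained by g by
    unconstrained positions, where [psum_renew] applies.  The word x is the part of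
    the current run that has been read already. *)
Lemma psumI x f g n : apart f g n -> x = [::] \/ ((0 < n)%N -> full (g 0%N)) ->
  psum x (fun i => predI (f i) (g i)) n = psum x f n * psum [::] g n.
Proof.
elim: n x f g => [|n IH] x f g fg h; first by rewrite /= p_nil mulr1.
(* the current run goes on in the first pattern, whichever of the two this is *)
have step f' g' y : apart f' g' n.+1 -> full (g' 0%N) -> ~ full (f' 0%N) ->
    psum y (fun i => predI (f' i) (g' i)) n.+1 = psum y f' n.+1 * psum [::] g' n.+1.
  move=> fg' g0 f0; rewrite (psum_behead _ g0) /= big_distrl /=.
  apply: eq_big => [a|a _]; first by rewrite /= g0 andbT.
  apply: IH; first exact: apartS.
  right => n0; have [//|//] := fg' 0%N 1%N isT n0 isT isT.
have [f0|f0] := pselect (full (f 0%N)); have [g0|g0] := pselect (full (g 0%N)).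
- rewrite psum_renew; last by move=> a /=; rewrite f0 g0.
  rewrite IH; [|exact: apartS|by left].
  by rewrite mulrA -psum_renew // -psum_behead.
- case: h => [->|h]; last by case: g0; exact: h.
  rewrite mulrC -step //; last exact: apartC.
  by apply: eq_psum => i _ a /=; rewrite andbC.
- exact: step.
- by have [] := fg 0%N 0%N isT isT isT isT.
Qed.

(** A pattern is the disjoint union of its refinements at one position. *)
Lemma psum_split x f n k : (k < n)%N ->
  psum x f n = \sum_(a : A) psum x (fun i b => f i b && ((i == k) ==> (b == a))) n.
Proof.
elim: n x f k => [|n IH] x f [|k] //= kn.
  rewrite big_mkcond /=; apply: eq_bigr => a _.
  case: ifP => fa.
    rewrite (big_pred1 a) /=; last by move=> b; rewrite /= andbC; case: eqP => //= ->.
    by apply: eq_psum => i _ b; rewrite /= andbT.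
  by rewrite big1 // => b /andP [fb /eqP ba]; rewrite ba fa in fb.
rewrite [RHS](exchange_big_dep (f 0%N)) /=; last by move=> a b _ /andP [].
apply: eq_bigr => b fb; rewrite (IH _ _ k) //.
apply: eq_big => [a|a _]; first by rewrite fb.
by apply: eq_psum.
Qed.

Lemma psum_empty x f n k : (k < n)%N -> (forall a, ~~ f k a) -> psum x f n = 0.
Proof.
elim: n x f k => [|n IH] x f [|k] //= kn h; apply: big1 => a fa.
  by move: (h a); rewrite fa.
by apply: (IH _ _ k).
Qed.

Lemma psum_double x f n k a : (k.+1 < n)%N -> (forall y b z, p (y ++ b :: b :: z) = 0) ->
  (forall b, f k b -> b = a) -> (forall b, f k.+1 b -> b = a) -> psum x f n = 0.
Proof.
move=> kn p_double fk fk1.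
have z y m g z : psum (y ++ a :: a :: z) g m = 0.
  elim: m g z => [|m IH] g z //=; apply: big1 => b _.
  by rewrite rcons_cat; exact: IH.
elim: n x f k kn fk fk1 => [|n IH] x f k // kn fk fk1.
case: k kn fk fk1 => [|k] kn fk fk1 /=; last by apply: big1 => b fb; exact: (IH _ _ k).
case: n kn {IH} => // n _ /=.
apply: big1 => b /fk ->; apply: big1 => c /fk1 ->.
by rewrite -!cats1 -catA; exact: z.
Qed.

End Patterns.

(** * Weights of patterns on countably many independent chains *)
(** A family of constraints that are vacuous outside a finite set. *)
Definition finsupp (I : eqType) (A : finType) (phi : I -> pred A) :=
  exists s : seq I, forall i, i \notin s -> full (phi i).

Lemma finsuppI (I : eqType) (A : finType) (phi psi : I -> pred A) :
  finsupp phi -> finsupp psi -> finsupp (fun i => predI (phi i) (psi i)).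
Proof.
move=> [s hs] [t ht]; exists (s ++ t) => i; rewrite mem_cat negb_or => /andP [si ti] a.
by rewrite /= hs // ht.
Qed.

Section ChainWeights.
Local Open Scope ring_scope.
Variables (R : realFieldType) (A : finType) (p : seq A -> R).
Hypothesis p_ge0 : forall w, 0 <= p w.
Hypothesis p_nil : p [::] = 1.
Hypothesis p_mid : forall x y, \sum_(a : A) p (x ++ a :: y) = p x * p y.

Implicit Types (h : int -> pred A).

Definition window_sum a n h : R := psum p [::] (fun i : nat => h (a + i%:Z)) n.

Definition in_window (a : int) (n : nat) h :=
  forall j : int, ~~ (a <= j < a + n%:Z) -> full (h j).

(** Unconstrained positions at either end of a window can be dropped, by
    [psum_behead] and [psum_belast]. *)
Lemma window_sum_widen a n h l r : in_window a n h -> window_sum (a - l%:Z) (l + n + r) h = window_sum a n h.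
Proof.
move=> ah; have -> : window_sum (a - l%:Z) (l + n + r) h = window_sum (a - l%:Z) (l + n) h.
  elim: r => [|r IH]; first by rewrite addn0.
  by rewrite addnS /window_sum psum_belast //; apply: ah; lia.
elim: l => [|l IH]; first by rewrite subr0.
rewrite -IH addSn /window_sum psum_behead //; last by apply: ah; lia.
apply: eq_psum => i _ b; congr (h _ b); lia.
Qed.

Lemma window_sum_eq a n b m h : in_window a n h -> in_window b m h -> window_sum a n h = window_sum b m h.
Proof.
move=> ha hb; pose lo : int := Num.min a b; pose hi : int := Num.max (a + n%:Z) (b + m%:Z).
have loa : lo <= a by rewrite ge_min lexx.
have lob : lo <= b by rewrite ge_min lexx orbT.
have hia : a + n%:Z <= hi by rewrite le_max lexx.
have hib : b + m%:Z <= hi by rewrite le_max lexx orbT.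
rewrite -(window_sum_widen (absz (a - lo)%R) (absz (hi - (a + n%:Z))%R) ha).
rewrite -(window_sum_widen (absz (b - lo)%R) (absz (hi - (b + m%:Z))%R) hb).
have -> : a - (absz (a - lo)%R)%:Z = b - (absz (b - lo)%R)%:Z by lia.
congr (window_sum _ _ h); lia.
Qed.

(** The weight of a pattern on the integers with constraints in a finite window;
    by [window_sum_eq] any window that contains them may be used.  Patterns without a
    window get the junk value 0. *)
Definition chain_wt h : R :=
  if pselect (exists w : int * nat, in_window w.1 w.2 h) is left e
  then let w := projT1 (cid e) in window_sum w.1 w.2 h else 0.

Lemma chain_wtE a n h : in_window a n h -> chain_wt h = window_sum a n h.
Proof.
move=> ah; rewrite /chain_wt; case: pselect => [e|[]]; last by exists (a, n).
by case: cid => w hw /=; apply: window_sum_eq.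
Qed.

Lemma chain_wt_ge0 h : 0 <= chain_wt h.
Proof. by rewrite /chain_wt; case: pselect => // e; exact: psum_ge0. Qed.

Lemma chain_wt_full h : (forall j, full (h j)) -> chain_wt h = 1.
Proof. by move=> hf; rewrite (@chain_wtE 0 0%N) // => j _; exact: hf. Qed.

(** One-dependence of the law on the integers. *)
Lemma chain_wtI a n h h' : in_window a n h -> in_window a n h' ->
  (forall i j, i <= j + 1 -> j <= i + 1 -> full (h i) \/ full (h' j)) ->
  chain_wt (fun j => predI (h j) (h' j)) = chain_wt h * chain_wt h'.
Proof.
move=> ha ha' ap; rewrite (chain_wtE ha) (chain_wtE ha') (@chain_wtE a n); last first.
  by move=> j nj b; rewrite /= (ha j nj) (ha' j nj).
rewrite /window_sum -psumI //; last by left.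
by move=> i j _ _ ij ji; apply: ap; lia.
Qed.

(** Stationarity: a window carries no memory of its location. *)
Lemma chain_wt_shift a n h s : in_window a n h -> chain_wt (fun j => h (j + s)) = chain_wt h.
Proof.
move=> ha; rewrite (chain_wtE ha) (@chain_wtE (a - s) n); last first.
  by move=> j nj; apply: ha; lia.
by apply: eq_psum => i _ b; congr (h _ b); lia.
Qed.

Lemma chain_wt_split a n h k : in_window a n h -> chain_wt h =
  \sum_(b : A) chain_wt (fun j c => h j c && ((j == k) ==> (c == b))).
Proof.
move=> ha.
pose lo : int := Num.min a k; pose hi : int := Num.max (a + n%:Z) (k + 1).
have loa : lo <= a by rewrite ge_min lexx.
have lob : lo <= k by rewrite ge_min lexx orbT.
have hia : a + n%:Z <= hi by rewrite le_max lexx.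
have hib : k + 1 <= hi by rewrite le_max lexx orbT.
have lh : in_window lo (absz (hi - lo)%R) h by move=> j nj; apply: ha; lia.
rewrite (chain_wtE lh) /window_sum (@psum_split _ _ _ _ _ _ (absz (k - lo)%R)); last by lia.
apply: eq_bigr => b _; rewrite (@chain_wtE lo (absz (hi - lo)%R)); last first.
  by move=> j nj c; rewrite lh //=; have /negbTE -> : j != k by lia.
apply: eq_psum => i _ c; congr (_ && (_ ==> _)); lia.
Qed.

Lemma chain_wt_empty h k : (forall a, ~~ h k a) -> chain_wt h = 0.
Proof.
move=> hk; rewrite /chain_wt; case: pselect => // e; case: cid => -[a n] /= ha.
have [a0|nA] := pselect (exists a : A, True); last first.
  by have := p_mid [::] [::]; rewrite p_nil mulr1 big1 => [/eqP|b]; [rewrite eq_sym oner_eq0|case: nA; exists b].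
have [b _] := a0; have kw : a <= k < a + n%:Z.
  by apply: contraT => /ha /(_ b) hb; move: (hk b); rewrite hb.
apply: (@psum_empty _ _ _ _ _ _ (absz (k - a)%R)); first by lia.
move=> c; have -> : a + (absz (k - a)%R)%:Z = k by lia.
exact: hk.
Qed.

Lemma chain_wt_double h k a : (forall y b z, p (y ++ b :: b :: z) = 0) ->
  (forall b, h k b -> b = a) -> (forall b, h (k + 1) b -> b = a) -> chain_wt h = 0.
Proof.
move=> pd hk hk1; rewrite /chain_wt; case: pselect => // e; case: cid => -[lo n] /= ha.
have := window_sum_widen (absz (lo - k)%R) (absz (k + 2 - lo)%R) ha.
set c : int := lo - _; set m := (_ + _ + _)%N => <-.
have ck : c <= k by rewrite /c; lia.
have cm : k + 1 < c + m%:Z by rewrite /c /m; lia.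
apply: (@psum_double _ _ _ _ _ _ (absz (k - c)%R) a) => //; first by lia.
  by have -> : c + (absz (k - c)%R)%:Z = k by lia.
by have -> : c + (absz (k - c)%R).+1%:Z = k + 1 by lia.
Qed.

Variable K : choiceType.
Implicit Types (phi psi : K * int -> pred A).

(** Distinct chains are independent: the weight of a pattern is the product of the weights
    of its restrictions to the chains.  All but finitely many factors are 1. *)
Definition wt phi : R := \big[*%R/1]_(k \in [set: K]) chain_wt (fun j => phi (k, j)).

Lemma wtE (s : seq K) phi : uniq s -> (forall k j, k \notin s -> full (phi (k, j))) ->
  wt phi = \prod_(k <- s) chain_wt (fun j => phi (k, j)).
Proof.
move=> us sphi; rewrite /wt (@fsbigE _ _ _ _ setT s) //.
  by apply: eq_bigl => k; rewrite in_setT.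
by move=> k _ ks; apply: chain_wt_full => j; apply: sphi.
Qed.

Lemma finsupp_window phi : finsupp phi -> exists (s : seq K) (N : nat),
  [/\ uniq s, (forall k j, k \notin s -> full (phi (k, j)))
    & forall k, in_window (- N%:Z) (N + N) (fun j => phi (k, j))].
Proof.
case=> s sphi; exists (undup (map fst s)), (\max_(i <- s) `|i.2|.+1)%N; split.
- exact: undup_uniq.
- move=> k j; rewrite mem_undup => ks; apply: sphi; apply: contra ks => ks.
  by apply/mapP; exists (k, j).
- move=> k j nj; apply: sphi; apply: contra nj => ks.
  have := @leq_bigmax_seq _ s xpredT (fun i => `|i.2|.+1)%N _ ks isT; rewrite /=; lia.
Qed.

Lemma wt_ge0 phi : 0 <= wt phi.
Proof. by apply: prodr_ge0 => k _; exact: chain_wt_ge0. Qed.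

Lemma wt_full phi : (forall i, full (phi i)) -> wt phi = 1.
Proof. by move=> h; rewrite (@wtE [::]) ?big_nil // => k j _; exact: h. Qed.

Lemma windows2 phi psi : finsupp phi -> finsupp psi -> exists (s : seq K) (N : nat),
  [/\ uniq s, (forall k j, k \notin s -> full (phi (k, j)) /\ full (psi (k, j)))
    & forall k, in_window (- N%:Z) (N + N) (fun j => phi (k, j)) /\
                in_window (- N%:Z) (N + N) (fun j => psi (k, j))].
Proof.
move=> /finsupp_window [s [N [us hs hN]]] /finsupp_window [t [M [ut ht hM]]].
exists (undup (s ++ t)), (maxn N M); split; first exact: undup_uniq.
  move=> k j; rewrite mem_undup mem_cat negb_or => /andP [ks kt].
  by split; [exact: hs|exact: ht].
by move=> k; split => j nj; [apply: hN|apply: hM]; lia.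
Qed.

Lemma wtI phi psi : finsupp phi -> finsupp psi ->
  (forall k i j, i <= j + 1 -> j <= i + 1 -> full (phi (k, i)) \/ full (psi (k, j))) ->
  wt (fun i => predI (phi i) (psi i)) = wt phi * wt psi.
Proof.
move=> fphi fpsi ap; have [s [N [us hs hN]]] := windows2 fphi fpsi.
rewrite (@wtE s) //; last by move=> k j /(hs k j) [h h'] a; rewrite /= h h'.
rewrite (@wtE s phi) //; last by move=> k j /(hs k j) [].
rewrite (@wtE s psi) //; last by move=> k j /(hs k j) [].
rewrite -big_split; apply: eq_bigr => k _; have [h h'] := hN k.
exact: (chain_wtI h h' (ap k)).
Qed.

Lemma wt_split phi (i : K * int) : finsupp phi ->
  wt phi = \sum_(a : A) wt (fun l b => phi l b && ((l == i) ==> (b == a))).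
Proof.
case: i => k0 j0 fphi; have [s [N [us hs hN]]] := finsupp_window fphi.
pose t := k0 :: rem k0 s.
have ut : uniq t by rewrite /= mem_rem_uniqF // rem_uniq.
have ht k j : k \notin t -> full (phi (k, j)).
  by rewrite inE (mem_rem_uniq k0 us) !inE negb_or negb_and negbK => /andP [/negbTE ->] /=; exact: hs.
rewrite (wtE ut ht) big_cons (chain_wt_split j0 (hN k0)) big_distrl /=.
apply: eq_bigr => a _; rewrite (wtE ut) ?big_cons; last first.
  move=> k j kt b; rewrite ht //=; case: eqP => //= -[kk _].
  by move: kt; rewrite kk inE eqxx.
congr (_ * _); first by congr chain_wt; apply: funext => j; apply: funext => b; rewrite xpair_eqE eqxx.
rewrite !big_seq; apply: eq_bigr => k kr; congr chain_wt; apply: funext => j; apply: funext => b.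
rewrite xpair_eqE; have /negbTE -> : k != k0 by apply: contraTneq kr => ->; rewrite mem_rem_uniqF.
by rewrite andbT.
Qed.

Lemma wt_empty phi i : finsupp phi -> (forall a, ~~ phi i a) -> wt phi = 0.
Proof.
case: i => k j [s hs] e; have [us|] := pselect (k \in undup (map fst s)).
  rewrite (@wtE (undup (map fst s))); first last.
  - move=> k' j' ks; apply: hs; apply: contra ks => ks.
    by rewrite mem_undup; apply/mapP; exists (k', j').
  - exact: undup_uniq.
  by rewrite (big_rem k us) /= (@chain_wt_empty _ j) // mul0r.
move/negP; rewrite mem_undup => ks.
have fk : full (phi (k, j)).
  by apply: hs; apply: contra ks => ks; apply/mapP; exists (k, j).
have [[a _]|nA] := pselect (exists a : A, True); first by move: (e a); rewrite fk.
by have := p_mid [::] [::]; rewrite p_nil mulr1 big1 => [/eqP|b]; [rewrite eq_sym oner_eq0|case: nA; exists b].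
Qed.

(** A relabelling of the chains together with a translation within each chain preserves
    weights.  This is how translations of the lattice act on the lines. *)
Lemma wt_shift phi psi (sg : K -> K) (sh : K -> int) : finsupp phi -> injective sg ->
  (forall k j, psi (sg k, j + sh k) = phi (k, j)) ->
  (forall k j, ~ range sg k -> full (psi (k, j))) -> wt psi = wt phi.
Proof.
move=> /finsupp_window [s [N [us hs hN]]] injs psiE psiF.
rewrite (wtE us hs) (@wtE (map sg s)); last 2 first.
- by rewrite map_inj_uniq.
- move=> k' j ks; have [[k _ kk]|] := pselect (range sg k'); last by move/psiF.
  rewrite -kk -(subrK (sh k) j) psiE; apply: hs.
  by apply: contra ks => ks; rewrite -kk map_f.
rewrite big_map; apply: eq_bigr => k _.
rewrite -(chain_wt_shift (- sh k) (hN k)); congr chain_wt; apply: funext => j.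
by rewrite -psiE subrK.
Qed.

Lemma wt_double phi k j a : (forall y b z, p (y ++ b :: b :: z) = 0) -> finsupp phi ->
  (forall b, phi (k, j) b -> b = a) -> (forall b, phi (k, j + 1) b -> b = a) ->
  wt phi = 0.
Proof.
move=> pd fphi h h1; have [s [N [us hs hN]]] := finsupp_window fphi.
have z : chain_wt (fun j => phi (k, j)) = 0 by exact: (chain_wt_double pd h h1).
rewrite (wtE us hs); have [ks|ks] := boolP (k \in s).
  by rewrite (big_rem k ks) /= z mul0r.
have /eqP := oner_neq0 R; case.
by rewrite -z chain_wt_full // => l; exact: hs.
Qed.

End ChainWeights.

(** * A process with prescribed word probabilities on the unit interval *)
Section WordMeasure.
Local Open Scope classical_set_scope.
Local Open Scope ring_scope.
Variables (R : realType) (q : nat).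
Notation A := 'I_q.+1.
Variable p : seq A -> R.
Hypothesis p_ge0 : forall w, 0 <= p w.
Hypothesis p_nil : p [::] = 1.
Hypothesis p_rcons : forall w, \sum_(a : A) p (rcons w a) = p w.

(** The interval of a word w is cut, from left to right, into the intervals of the words
    rcons w a; the k-th cut is at distance cum w k from the left end. *)
Definition cum (w : seq A) (k : nat) : R := \sum_(b : A | (b < k)%N) p (rcons w b).

Fixpoint left_from (u w : seq A) : R :=
  if w is a :: w' then cum u a + left_from (rcons u a) w' else 0.

Definition left_end w := left_from [::] w.

Lemma left_end_rcons w a : left_end (rcons w a) = left_end w + cum w a.
Proof.
suff h u : left_from u (rcons w a) = left_from u w + cum (u ++ w) a by exact: h.
elim: w u => [|b w IH] u /=; first by rewrite addr0 add0r cats0.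
by rewrite IH addrA cat_rcons.
Qed.

Lemma cum0 w : cum w 0 = 0.
Proof. by rewrite /cum big_pred0. Qed.

Lemma cumS w (a : A) : cum w a.+1 = cum w a + p (rcons w a).
Proof.
rewrite /cum (bigD1 a) //= addrC; congr (_ + _); apply: eq_bigl => b.
by rewrite ltnS ltn_neqAle andbC.
Qed.

Lemma cum_all w : cum w q.+1 = p w.
Proof. by rewrite -p_rcons; apply: eq_bigl => b; rewrite ltn_ord. Qed.

Lemma cum_le w k l : (k <= l)%N -> cum w k <= cum w l.
Proof.
move=> kl; rewrite /cum [X in _ <= X](bigID (fun b : A => (b < k)%N)) /=.
rewrite -[X in X <= _]addr0; apply: lerD; last by apply: sumr_ge0.
rewrite le_eqVlt; apply/orP; left; apply/eqP; apply: eq_bigl => b.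
by case: (ltnP b k) => bk; rewrite ?andbF // andbT (leq_trans bk).
Qed.

(** The letter a such that x lies in the interval of rcons w a, when x lies in the
    interval of w.  The first and the last letter also take the points to the left and to
    the right, so that the sets of constancy are intervals. *)
Definition letter (w : seq A) (x : R) : A :=
  inord (find (fun a => x < left_end w + cum w a.+1) (iota 0 q)).

Lemma letterE w x (a : A) : letter w x = a <->
  ((0 < a)%N -> left_end w + cum w a <= x) /\
  ((a < q)%N -> x < left_end w + cum w a.+1).
Proof.
rewrite /letter; set P := fun a => _; have fq : (find P (iota 0 q) < q.+1)%N.
  by rewrite ltnS -[X in (_ <= X)%N](size_iota 0 q) find_size.
have mono k l : (k <= l)%N -> P k -> P l.
  move=> kl; rewrite /P => /lt_le_trans; apply.
  by rewrite lerD2l; apply: cum_le.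
split=> [<-|[lo hi]].
  rewrite inordK //; split => h.
    rewrite leNgt; apply/negP => px.
    have k0 : (0 < find P (iota 0 q))%N by [].
    have := @before_find _ 0%N P (iota 0 q) (find P (iota 0 q)).-1.
    rewrite prednK // leqnn nth_iota; last by rewrite prednK // -ltnS.
    by rewrite add0n /P prednK // -/P px => /(_ isT).
  have hs : has P (iota 0 q) by rewrite has_find size_iota.
  by have := nth_find 0%N hs; rewrite nth_iota.
apply: val_inj; rewrite /= inordK //; apply/eqP; rewrite eqn_leq; apply/andP; split.
  have [aq|aq] := ltnP a q; last by rewrite -ltnS (leq_trans fq).
  rewrite leqNgt; apply/negP => /(@before_find _ 0%N).
  by rewrite nth_iota // add0n => /negP; apply; exact: hi.
rewrite leqNgt; apply/negP => fa.
have hs : has P (iota 0 q) by rewrite has_find size_iota (leq_trans fa) // -ltnS.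
have := nth_find 0%N hs; rewrite nth_iota; last by rewrite (leq_trans fa) // -ltnS.
rewrite add0n /P => h; have a0 : (0 < a)%N by exact: leq_trans fa.
have := lt_le_trans h _; move/(_ (left_end w + cum w a)); rewrite lerD2l cum_le // => /(_ isT).
by rewrite ltNge lo.
Qed.

Fixpoint word_at n (x : R) : seq A :=
  if n is n'.+1 then rcons (word_at n' x) (letter (word_at n' x) x) else [::].

Lemma measurable_letter w a : measurable [set x : measurableTypeR R | letter w x = a].
Proof.
have -> : [set x : measurableTypeR R | letter w x = a] =
   (if (0 < a)%N then `[left_end w + cum w a, +oo[%classic else setT) `&`
   (if (a < q)%N then `]-oo, left_end w + cum w a.+1[%classic else setT).
  apply/seteqP; split => x.
    move=> /= /letterE [lo hi]; split.
      by case: ifP => // /lo; rewrite /= in_itv /= andbT.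
    by case: ifP => // /hi; rewrite /= in_itv.
  move=> [lo hi]; apply/letterE; split => h.
    by move: lo; rewrite h /= in_itv /= andbT.
  by move: hi; rewrite h /= in_itv.
by apply: measurableI; case: ifP => _ //; exact: measurable_itv.
Qed.

Lemma measurable_word_at w : measurable [set x : measurableTypeR R | word_at (size w) x = w].
Proof.
elim/last_ind: w => [|w a IH] /=; first by rewrite (_ : [set _ | _] = setT) //; apply/seteqP; split.
rewrite size_rcons /= (_ : [set _ | _] = [set x | word_at (size w) x = w] `&` [set x | letter w x = a]).
  by apply: measurableI => //; exact: measurable_letter.
apply/seteqP; split => x /=; first by move/rcons_inj => -[-> ->].
by move=> [-> ->].
Qed.

(** The points of [0, 1) whose first letters are w form the interval of w. *)
Lemma word_at_itv w x : 0 <= x < 1 ->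
  word_at (size w) x = w <-> left_end w <= x < left_end w + p w.
Proof.
move=> x01; elim/last_ind: w => [|w a IH] /=.
  by rewrite /left_end /= p_nil add0r x01.
rewrite size_rcons /= left_end_rcons -addrA -cumS.
have in_a : left_end w + cum w a <= x < left_end w + cum w a.+1 ->
    left_end w <= x < left_end w + p w.
  move=> /andP [lo hi]; apply/andP; split.
    by apply: le_trans lo; rewrite -[X in X <= _]addr0 lerD2l -(cum0 w) cum_le.
  by apply: (lt_le_trans hi); rewrite lerD2l -cum_all cum_le.
split => [/rcons_inj [wx ax]|h].
  move: ax; rewrite wx => /letterE [lo hi].
  move/IH: wx => /andP [lo' hi']; apply/andP; split.
    by case: (posnP a) => [->|/lo //]; rewrite cum0 addr0.
  have [|aq] := ltnP a q; first exact: hi.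
  have -> : a.+1 = q.+1 by apply/eqP; rewrite eqSS eqn_leq aq -ltnS ltn_ord.
  by rewrite cum_all.
have -> : word_at (size w) x = w by apply/IH; exact: in_a.
by congr rcons; apply/letterE; case/andP: h.
Qed.

Lemma left_end_bound w : 0 <= left_end w /\ left_end w + p w <= 1.
Proof.
elim/last_ind: w => [|w a [IH0 IH1]]; first by rewrite /left_end /= p_nil add0r.
rewrite left_end_rcons -addrA -cumS; split.
  by rewrite addr_ge0 // /cum sumr_ge0.
by apply: le_trans IH1; rewrite lerD2l -cum_all cum_le.
Qed.

Lemma uniform01_itv (a b : R) : 0 <= a -> a <= b -> b <= 1 ->
  uniform_prob (@ltr01 R) (`[a, b[%classic) = (b - a)%:E.
Proof.
move=> a0 ab b1; rewrite /uniform_prob.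
rewrite (eq_integral (fun=> 1%:E)); last first.
  move=> x; rewrite inE /= in_itv /= => /andP [ax xb]; rewrite /uniform_pdf.
  by rewrite (le_trans a0 ax) (le_trans (ltW xb) b1) /= subr0 invr1.
rewrite integral_cst //= mul1e.
rewrite lebesgue_measure_itv /= lte_fin; case: ltP => // ba.
have -> : b = a by apply/eqP; rewrite eq_le ba ab.
by rewrite subrr.
Qed.

Lemma prob_word_at w :
  uniform_prob (@ltr01 R) [set x | word_at (size w) x = w] = (p w)%:E.
Proof.
set E := [set x | _]; pose P : probability (measurableTypeR R) R := uniform_prob (@ltr01 R).
rewrite -[uniform_prob _ _]/(P E); pose D : set R := `[0, 1[%classic.
have mD : measurable (D : set (measurableTypeR R)) by exact: measurable_itv.
have mE : measurable (E : set (measurableTypeR R)) by exact: measurable_word_at.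
have PD : P D = 1%:E by rewrite [LHS]uniform01_itv // subr0.
have PD' : P (~` D) = 0%:E.
  have := probability_setC P mD; rewrite PD => ->.
  by rewrite -EFinB subrr.
have -> : P E = P (E `&` D).
  rewrite -[in LHS](setIT E) -(setUv D) setIUr measureU //; first last.
  - by rewrite setIACA setICr setI0.
  - by apply: measurableI => //; exact: measurableC.
  - exact: measurableI.
  rewrite [X in _ + X]( _ : _ = 0%:E) ?adde0 //.
  apply/eqP; rewrite eq_le measure_ge0 andbT -PD'.
  by apply: le_measure; rewrite ?inE //; do ?apply: measurableI => //; exact: measurableC.
have [l0 l1] := left_end_bound w.
have -> : E `&` D = `[left_end w, left_end w + p w[%classic.
  apply/seteqP; split => x; rewrite /E /D /= !in_itv /=.
    by move=> [xw x01]; apply/word_at_itv.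
  move=> xw; have x01 : 0 <= x < 1.
    by case/andP: xw => h1 h2; rewrite (le_trans l0 h1) (lt_le_trans h2 l1).
  by split => //; apply/word_at_itv.
rewrite [LHS]uniform01_itv //; last by rewrite lerDl.
by rewrite addrC addKr.
Qed.

(** Kolmogorov's extension theorem for sequences with finitely many values, by an explicit
    coding of the points of the unit interval. *)
Lemma exists_word_process : exists (X : nat -> measurableTypeR R -> A),
  forall w, let E := [set x : measurableTypeR R | mkseq (X^~ x) (size w) = w] in
  measurable E /\ uniform_prob (@ltr01 R) E = (p w)%:E.
Proof.
exists (fun n x => letter (word_at n x) x) => w E.
have e x n : mkseq (fun k => letter (word_at k x) x) n = word_at n x.
  by elim: n => // n IH; rewrite mkseqS IH.
have -> : E = [set x | word_at (size w) x = w].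
  by apply/seteqP; split => x; rewrite /E /= e.
by split; [exact: measurable_word_at|exact: prob_word_at].
Qed.

End WordMeasure.

(** * From pattern weights to a process with a countable index set *)
Section PatternMeasure.
Local Open Scope classical_set_scope.
Local Open Scope ring_scope.

Lemma prob_partition (R : realType) d (T : measurableType d)
    (P : probability T R) (n : nat) (E : set T) (f : T -> 'I_n) :
  measurable E -> (forall a, measurable [set x | f x = a]) ->
  P E = (\sum_(a < n) P (E `&` [set x | f x = a]))%E.
Proof.
move=> mE mf.
have eE : E = \big[setU/set0]_(a < n) (E `&` [set x | f x = a]).
  apply/seteqP; split => x.
    by move=> Ex; rewrite -bigcup_seq; exists (f x) => //=; rewrite mem_index_enum.
  by rewrite -bigcup_seq => -[a _ []].
rewrite [in LHS]eE measure_semi_additive_ord //.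
- by move=> a; exact: measurableI.
- apply/trivIsetP => a b _ _ ab; apply/seteqP; split => x //= [[_ ax] [_ bx]].
  by move: ab; rewrite -ax -bx eqxx.
- by rewrite -eE.
Qed.

Variables (R : realType) (q : nat) (I : countType).
Notation A := 'I_q.+1.
Variable wt : (I -> pred A) -> R.
Hypothesis wt_ge0 : forall phi, 0 <= wt phi.
Hypothesis wt_full : wt (fun _ _ => true) = 1.
Hypothesis wt_empty : forall phi i, finsupp phi -> (forall a, ~~ phi i a) -> wt phi = 0.
Hypothesis wt_split : forall phi i, finsupp phi ->
  wt phi = \sum_(a : A) wt (fun l b => phi l b && ((l == i) ==> (b == a))).

Definition cylinder (w : seq A) (i : I) : pred A := fun b =>
  (pickle i < size w)%N ==> (b == nth ord0 w (pickle i)).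

(** Words are indexed by the codes of the elements of I.  Since pickle need not be
    surjective, the letters at the other positions are frozen to 0, to keep the word
    probabilities consistent. *)
Definition coded_at (n : nat) (a : A) : bool :=
  (pickle_inv n != None :> option I) || (a == ord0).

Definition coded (w : seq A) : bool :=
  all (fun n => coded_at n (nth ord0 w n)) (iota 0 (size w)).

Lemma coded_rcons w a : coded (rcons w a) = coded w && coded_at (size w) a.
Proof.
rewrite /coded size_rcons -(addn1 (size w)) iotaD all_cat /= andbT add0n nth_rcons ltnn eqxx.
congr (_ && _); apply: eq_in_all => n; rewrite mem_iota add0n => /= nw.
by rewrite nth_rcons nw.
Qed.

Lemma finsupp_cylinder w : finsupp (cylinder w).
Proof.
exists (pmap pickle_inv (iota 0 (size w))) => i iw a; rewrite /cylinder.
case: ltnP => //= h; move/negP: iw; case.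
rewrite mem_pmap; apply/mapP; exists (pickle i); last by rewrite pickleK_inv.
by rewrite mem_iota.
Qed.

Definition word_wt (phi : I -> pred A) (w : seq A) : R :=
  (coded w)%:R * wt (fun i => predI (cylinder w i) (phi i)).

Lemma sum_word_wt phi w : finsupp phi ->
  \sum_(a : A) word_wt phi (rcons w a) = word_wt phi w.
Proof.
move=> fphi; rewrite /word_wt.
under eq_bigr => a _ do rewrite coded_rcons -mulnb natrM -mulrA.
rewrite -big_distrr /=; congr (_ * _).
case e : (pickle_inv (size w) : option I) => [i|].
  rewrite [RHS](wt_split i) //; last by apply: finsuppI => //; exact: finsupp_cylinder.
  apply: eq_bigr => a _; rewrite /coded_at e /= mul1r; congr wt.
  have pi : pickle i = size w by have := @pickle_invK I (size w); rewrite e.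
  apply: funext => l; apply: funext => b; rewrite /= /cylinder size_rcons nth_rcons.
  rewrite andbAC; congr (_ && _); rewrite ltnS leq_eqVlt.
  have [lw|lw /=] := eqVneq (pickle l) (size w).
    have -> : l = i by apply: (pcan_inj pickleK); rewrite lw.
    by rewrite eqxx pi ltnn.
  have -> : (l == i) = false by apply: contra_neqF lw => /eqP ->.
  by rewrite andbT; case: ltnP.
rewrite (bigD1 ord0) //= /coded_at e eqxx mul1r big1; last first.
  by move=> a /negbTE ->; rewrite mul0r.
rewrite addr0; congr wt; apply: funext => l; apply: funext => b.
rewrite /= /cylinder size_rcons nth_rcons ltnS leq_eqVlt.
have -> : (pickle l == size w) = false.
  by apply/negP => /eqP lw; move: e; rewrite -lw pickleK_inv.
by case: ltnP.
Qed.

(** The event that phi holds is decomposed according to the first n letters of the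
    sequence of [exists_word_process].  Once n exceeds the codes of all constrained indices,
    each piece is either a word event or empty; [sum_word_wt] then removes the letters one
    by one. *)
Lemma exists_pattern_process : exists X : I -> measurableTypeR R -> A,
  (forall i a, measurable [set x | X i x = a]) /\
  forall phi, finsupp phi ->
    uniform_prob (@ltr01 R) [set x | forall i, phi i (X i x)] = (wt phi)%:E.
Proof.
pose P : probability (measurableTypeR R) R := uniform_prob (@ltr01 R).
have fT : finsupp (fun (_ : I) (_ : A) => true) by exists [::].
pose p w := word_wt (fun _ _ => true) w.
have pE w : p w = (coded w)%:R * wt (cylinder w).
  by congr (_ * wt _); apply: funext => l; apply: funext => b; rewrite /= andbT.
have [Y hY] : exists (X : nat -> measurableTypeR R -> A),
  forall w, let E := [set x : measurableTypeR R | mkseq (X^~ x) (size w) = w] in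
  measurable E /\ P E = (p w)%:E.
  apply: exists_word_process.
  - by move=> w; rewrite mulr_ge0.
  - by rewrite pE /coded /= mul1r -wt_full; congr wt.
  - by move=> w; exact: sum_word_wt.
have mY n a : measurable [set x | Y n x = a].
  rewrite (_ : [set _ | _] = \bigcup_(t : n.-tuple A) [set x | mkseq (Y^~ x) (size (rcons t a)) = rcons t a]).
    by apply: countable_bigcupT_measurable => // t; have [] := hY (rcons t a).
  apply/seteqP; split => x /=.
    move=> Ya; have st : size (mkseq (Y^~ x) n) == n by rewrite size_mkseq.
    by exists (Tuple st) => //=; rewrite size_rcons size_mkseq mkseqS Ya.
  by move=> [t _] /=; rewrite size_rcons size_tuple mkseqS => /rcons_inj [].
exists (fun i => Y (pickle i)); split => [i a|phi fphi]; first exact: mY.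
have [s hs] := fphi.
(* beyond N no index is constrained *)
pose N := (\max_(i <- s) (pickle i).+1)%N.
have hN i : (N <= pickle i)%N -> full (phi i).
  move=> h; apply: hs; apply/negP => si.
  by have := @leq_bigmax_seq _ s xpredT (fun i => (pickle i).+1) _ si isT; rewrite leqNgt ltnS h.
pose E w := [set x | mkseq (Y^~ x) (size w) = w /\ forall i, phi i (Y (pickle i) x)].
have mE0 : measurable [set x | forall i, phi i (Y (pickle i) x)].
  rewrite (_ : [set _ | _] = \bigcap_n
      [set x | forall i, pickle i = n -> phi i (Y n x)]); last first.
    apply/seteqP; split => x /= h; first by move=> n _ i <-.
    by move=> i; exact: (h (pickle i)).
  apply: bigcapT_measurable => n.
  rewrite (_ : [set _ | _] = \bigcup_(a in [set a | forall i, pickle i = n -> phi i a]) [set x | Y n x = a]).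
    by apply: fin_bigcup_measurable => // a _; exact: mY.
  apply/seteqP; split => x /=; first by move=> h; exists (Y n x).
  by move=> [a h /= ->].
have mE w : measurable (E w).
  rewrite (_ : E w = [set x | mkseq (Y^~ x) (size w) = w] `&` [set x | forall i, phi i (Y (pickle i) x)]) //.
  by apply: measurableI => //; have [] := hY w.
(* induction on the number m of letters that are still free *)
suff PE m w : (size w + m = N)%N -> P (E w) = (word_wt phi w)%:E.
  have := PE N [::] erefl; rewrite /word_wt /coded /= mul1r.
  rewrite (_ : E [::] = [set x | forall i, phi i (Y (pickle i) x)]); last first.
    by apply/seteqP; split => x; [case|split].
  by move=> h; rewrite [LHS]h; congr (wt _)%:E.
elim: m w => [|m IH] w szw.
  rewrite addn0 in szw.
  have [wphi|] := pselect (forall i, (pickle i < N)%N -> phi i (nth ord0 w (pickle i))).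
    rewrite (_ : E w = [set x | mkseq (Y^~ x) (size w) = w]); last first.
      apply/seteqP; split => x; first by case.
      move=> /= wx; split => // i; have [iN|iN] := ltnP (pickle i) N; last exact: hN.
      by have := wphi i iN; rewrite -{1}wx nth_mkseq // szw.
    rewrite (hY w).2 pE /word_wt; congr (_ * wt _)%:E.
    apply: funext => l; apply: funext => b; rewrite /= /cylinder szw.
    have [iN|iN] := ltnP (pickle l) N; last by rewrite hN.
    by case: eqP => //= ->; rewrite wphi.
  move=> /existsNP [i /not_implyP [iN /negP nphi]].
  rewrite (_ : E w = set0); last first.
    apply/seteqP; split => x //= -[wx /(_ i)].
    by move: nphi; rewrite -{1}wx nth_mkseq ?szw // => /negbTE ->.
  rewrite measure0 /word_wt (@wt_empty _ i) ?mulr0 //; first by apply: finsuppI => //; exact: finsupp_cylinder.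
  move=> a; rewrite /= /cylinder szw iN /=; apply/negP => /andP [/eqP ->].
  exact/negP.
rewrite (prob_partition P (mE w) (mY (size w))) -sum_word_wt // -sumEFin.
apply: eq_bigr => a _; rewrite -IH; last by rewrite size_rcons -szw addnS.
congr (P _); apply/seteqP; split => x; rewrite /E /= size_rcons mkseqS.
  by move=> [[-> h] ->].
by move=> [/rcons_inj [-> ->] h].
Qed.

End PatternMeasure.

(** * Pi-lambda arguments and cylinder events *)
Section PiLambda.
Local Open Scope classical_set_scope.
Local Open Scope ring_scope.

(** Both sides are finite measures of E of the same total mass c.  With f = g = idfun this
    yields independence from the event B; with B the whole space and c = 1 it yields
    equality of the laws of f and g. *)
Lemma pi_lambda_eq (R : realType) d (T : measurableType d) (P : probability T R)
    (U : Type) (G : set (set U)) (f g : T -> U) (B : set T) (c : R) :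
  setI_closed G -> 0 <= c -> measurable B -> P B = c%:E ->
  (forall E, G E -> [/\ measurable (f @^-1` E), measurable (g @^-1` E) &
     P (f @^-1` E `&` B) = (c%:E * P (g @^-1` E))%E]) ->
  forall E, <<s G >> E ->
     P (f @^-1` E `&` B) = (c%:E * P (g @^-1` E))%E.
Proof.
move=> GI c0 mB PB hG.
pose H := [set E : set U | [/\ measurable (f @^-1` E), measurable (g @^-1` E) &
     P (f @^-1` E `&` B) = (c%:E * P (g @^-1` E))%E]].
suff sub : <<s G >> `<=` H by move=> E /sub [].
apply: lambda_system_subset => //; apply/dynkin_lambda_system; split.
- by split; rewrite ?preimage_setT // setTI PB probability_setT mule1.
- move=> E [mf mg e].
  have eC (h : T -> U) : h @^-1` (~` E) = ~` (h @^-1` E) by [].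
  rewrite /H /= !eC; split; [exact: measurableC..|].
  rewrite setIC -setDE measureD //; last by rewrite ltey_eq fin_num_measure.
  rewrite [X in (X - _)%E]PB probability_setC // setIC [X in (_ - X)%E]e muleBr ?mule1 //.
- move=> F tF hF; have mf n : measurable (f @^-1` F n) by have [] := hF n.
  have mg n : measurable (g @^-1` F n) by have [] := hF n.
  split; rewrite ?preimage_bigcup; [exact: bigcupT_measurable..|].
  have tf : trivIset setT (fun n => f @^-1` F n `&` B).
    by move=> i j _ _ [x [[Fi _] [Fj _]]]; apply: tF => //; exists (f x).
  have tg : trivIset setT (fun n => g @^-1` F n).
    by move=> i j _ _ [x [Fi Fj]]; apply: tF => //; exists (g x).
  rewrite setI_bigcupl measure_bigcup //; last by move=> n _; exact: measurableI.
  rewrite measure_bigcup // -nneseriesZl //.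
  by apply: eq_eseriesr => n _; have [] := hF n.
Qed.

Lemma indep_pi (R : realType) d (T : measurableType d) (P : probability T R)
    (G1 G2 : set (set T)) :
  setI_closed G1 -> setI_closed G2 -> G1 `<=` measurable -> G2 `<=` measurable ->
  indep_systems P G1 G2 -> indep_systems P <<s G1 >> <<s G2 >>.
Proof.
move=> GI1 GI2 mG1 mG2 ind E1 E2 h1 h2.
have mE2 : measurable E2.
  by move: E2 h2; apply: smallest_sub => //; exact: sigma_algebra_measurable.
have main G B E : setI_closed G -> G `<=` measurable -> measurable B ->
    (forall E, G E -> P (E `&` B) = (P E * P B)%E) -> <<s G >> E ->
    P (E `&` B) = (P E * P B)%E.
  move=> GI mG mB' h hE; have fB : P B \is a fin_num by exact: fin_num_measure.
  rewrite -(fineK fB) muleC.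
  apply: (@pi_lambda_eq _ _ _ P _ G idfun idfun B) => //; rewrite ?fineK //.
  - by rewrite fine_ge0.
  - by move=> D GD; split; [exact: mG..|rewrite h // muleC].
apply: (main G1) => //.
move=> E GE; rewrite setIC muleC.
apply: (main G2) => //; first exact: mG1.
by move=> F GF; rewrite setIC muleC; exact: ind.
Qed.

Lemma sub_g_sigma_algebra (T : Type) (G H : set (set T)) :
  G `<=` <<s H >> -> <<s G >> `<=` <<s H >>.
Proof. by move=> GH; apply: smallest_sub => //; exact: smallest_sigma_algebra. Qed.

End PiLambda.

Section PatternLaw.
Local Open Scope classical_set_scope.
Local Open Scope ring_scope.
Variables (d : measure_display) (T : measurableType d) (q : nat) (I : countType).
Notation A := 'I_q.
Variable X : I -> T -> A.
Hypothesis mX : forall i a, measurable [set x | X i x = a].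

Definition box (phi : I -> pred A) : set T := [set x | forall i, phi i (X i x)].

(** A pi-system that generates the sigma-algebra of the coordinates in S. *)
Definition boxes (S : set I) : set (set T) :=
  [set E | exists phi, [/\ finsupp phi, (forall i, ~ S i -> full (phi i)) & E = box phi]].

Lemma measurable_preX i (B : set A) : measurable [set x | B (X i x)].
Proof.
rewrite (_ : [set _ | _] = \bigcup_(a in B) [set x | X i x = a]).
  by apply: fin_bigcup_measurable => // a _; exact: mX.
by apply/seteqP; split => x /=; [exists (X i x)|move=> [a Ba /= ->]].
Qed.

Lemma measurable_box phi : measurable (box phi).
Proof.
rewrite (_ : box phi = ~` (\bigcup_i [set x | ~~ phi i (X i x)])).
  apply: measurableC; apply: countable_bigcupT_measurable => // i.
  exact: (measurable_preX i [set a | ~~ phi i a]).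
apply/seteqP; split => x /=; first by move=> h [i _] /=; rewrite h.
by move=> h i; apply: contraPT h => nphi; apply; exists i.
Qed.

Lemma boxI phi psi : box phi `&` box psi = box (fun i => predI (phi i) (psi i)).
Proof.
apply/seteqP; split => x; first by move=> [h h'] i; rewrite /= h h'.
by move=> h; split => i; have /andP [] := h i.
Qed.

Lemma boxes_setI S : setI_closed (boxes S).
Proof.
move=> E F [phi [fphi Sphi ->]] [psi [fpsi Spsi ->]]; rewrite boxI.
exists (fun i => predI (phi i) (psi i)); split => //; first exact: finsuppI.
by move=> i Si a; rewrite /= Sphi // Spsi.
Qed.

Lemma sigma_restr_boxes (J : Type) (c : J -> I) (S : set J) :
  sigma_restr (fun j x => X (c j) x : nat) S `<=` <<s boxes (c @` S) >>.
Proof.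
apply: sub_g_sigma_algebra => E [j Sj [B _ <-]]; apply: sub_sigma_algebra.
exists (fun i (a : A) => (i == c j) ==> `[< B (a : nat) >]); split.
- by exists [:: c j] => i; rewrite inE => /negbTE /= -> a.
- move=> i Si a; case: eqP => //= ij; case: Si; exists j => //.
- rewrite setTI; apply/seteqP; split => x /=.
    by move=> Bx i; apply/implyP => /eqP ->; apply/asboolP.
  by move=> /(_ (c j)); rewrite eqxx /= => /asboolP.
Qed.

End PatternLaw.

(** * Independent chains along all lines of the lattice *)
Section LineCoordinates.
Local Open Scope ring_scope.
Variable d : nat.
Notation V := 'rV[int]_d.
Implicit Types (u v t : V) (m : int).

(** The integer position of v on the line v + Z u, measured by Euclidean division along the first
    nonzero coordinate of u.  For u = 0 every line is a single point. *)
Definition line_pos u v : int :=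
  if [pick i | u 0 i != 0] is Some i then divz (v 0 i) (u 0 i) else 0.

(** A canonical representative of the line v + Z u. *)
Definition line_rep u v : V := v - line_pos u v *: u.

Lemma line_posD u v m : u != 0 -> line_pos u (v + m *: u) = line_pos u v + m.
Proof.
move=> u0; rewrite /line_pos; case: pickP => [i ui|h].
  by rewrite !mxE addrC divzMDl // addrC.
case/eqP: u0; apply/rowP => i; rewrite mxE.
by have := h i => /negbFE/eqP.
Qed.

Lemma line_repD u v m : line_rep u (v + m *: u) = line_rep u v.
Proof.
have [->|u0] := eqVneq u 0; first by rewrite /line_rep !scaler0 addr0 !subr0.
by rewrite /line_rep line_posD // scalerDl opprD addrACA subrr addr0.
Qed.

Lemma line_rep_rep u v : line_rep u (line_rep u v) = line_rep u v.
Proof. by rewrite {2}/line_rep -scaleNr line_repD. Qed.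

Lemma line_repE u v : v = line_rep u v + line_pos u v *: u.
Proof. by rewrite subrK. Qed.

Lemma line_pos_rep u v x : line_pos u (x + line_pos u v *: u) = line_pos u x + line_pos u v.
Proof.
have [->|u0] := eqVneq u 0; last exact: line_posD.
have z y : line_pos 0 y = 0 by rewrite /line_pos; case: pickP => // i; rewrite mxE eqxx.
by rewrite !z.
Qed.

(** The copy of v indexed by u sits on the chain named after the direction u and the canonical
    representative of v + Z u. *)
Definition chain (i : V * V) : (V * V) * int := ((i.1, line_rep i.1 i.2), line_pos i.1 i.2).

(** The action of the translation by t on the names of the chains.  Pairs that do not name a
    chain are fixed, which makes the action injective. *)
Definition chain_tr t (k : V * V) : V * V :=
  if line_rep k.1 k.2 == k.2 then (k.1, line_rep k.1 (k.2 + t)) else k.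

Definition chain_sh t (k : V * V) : int :=
  if line_rep k.1 k.2 == k.2 then line_pos k.1 (k.2 + t) else 0.

Lemma chain_shift t u v : chain (u, v + t) =
  (chain_tr t (chain (u, v)).1, (chain (u, v)).2 + chain_sh t (chain (u, v)).1).
Proof.
rewrite /chain /chain_tr /chain_sh /= line_rep_rep eqxx.
have -> : v + t = line_rep u v + t + line_pos u v *: u by rewrite addrAC -line_repE.
by rewrite line_repD line_pos_rep [line_pos u v + _]addrC.
Qed.

Lemma chain_tr_inj t : injective (chain_tr t).
Proof.
have rt u r r' : line_rep u (r + t) = line_rep u (r' + t) -> line_rep u r = line_rep u r'.
  rewrite {1 2}/line_rep => e.
  have -> : r = r' + (line_pos u (r + t) - line_pos u (r' + t)) *: u.
    apply: (addIr t); rewrite addrAC scalerBl addrA.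
    by rewrite (addrAC (r' + t)) -e subrK.
  by rewrite line_repD.
move=> [u r] [u' r']; rewrite /chain_tr /=.
case: ifP => /eqP h; case: ifP => /eqP h' // [uu].
- by move: h'; rewrite -uu => h' /rt; rewrite h h' => ->.
- by move=> rr; case: h'; rewrite -uu -rr line_rep_rep.
- by move=> rr; case: h; rewrite uu rr line_rep_rep.
Qed.

Lemma chain_apart u v u' v' : (chain (u, v)).1 = (chain (u', v')).1 ->
  line_pos u v <= line_pos u' v' + 1 -> line_pos u' v' <= line_pos u v + 1 ->
  u = u' /\ exists2 m : int, `|m| <= 1 & v = v' + m *: u.
Proof.
case=> uu; rewrite -uu => rr h h'; split=> //; exists (line_pos u v - line_pos u v'); first by lia.
rewrite scalerBl addrCA [RHS]addrC -[v' - _]/(line_rep u v') -rr; exact: line_repE.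
Qed.

End LineCoordinates.

Section LineProcess.
Local Open Scope classical_set_scope.
Local Open Scope ring_scope.
Variables (R : realType) (d : nat).
Notation V := 'rV[int]_d.

(** Independent one-dependent 4-colourings of all lines: for each direction u, the values at v
    and v + u differ, values whose indices are not equal or adjacent on a common line are
    independent, and the law is invariant under translations. *)
Theorem exists_line_process :
  exists Z : V * V -> measurableTypeR R -> 'I_4,
  let P := uniform_prob (@ltr01 R) : probability (measurableTypeR R) R in
  let Zn := fun i x => Z i x : nat in
  [/\ forall i a, measurable [set x | Z i x = a],
      forall u v, u != 0 -> P [set x | Z (u, v) x = Z (u, v + u) x] = 0%E,
      forall S1 S2 : set (V * V),
        (forall u v v' m, S1 (u, v) -> S2 (u, v') -> `|m| <= 1 -> v != v' + m *: u) ->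
        indep_systems P (sigma_restr Zn S1) (sigma_restr Zn S2)
    & forall (t : V) (D : set (V * V -> nat)), sigma_restr (fun i z => z i) setT D ->
        P [set x | D (fun i => Zn (i.1, i.2 + t) x)] = P [set x | D (fun i => Zn i x)]].
Proof.
pose p := @hl_prob R.
have pD : forall x y, \sum_(a : 'I_4) p (x ++ a :: y) = p x * p y by exact: hl_prob_mid.
have p0 : p [::] = 1 by exact: hl_prob_nil.
have pp : forall w, 0 <= p w by exact: hl_prob_ge0.
have pd : forall y b z, p (y ++ b :: b :: z) = 0 by exact: hl_prob_double.
pose K : countType := (V * V)%type.
pose w := @wt R _ p K.
have [X [mX PX]] : exists X : K * int -> measurableTypeR R -> 'I_4,
  (forall i a, measurable [set x | X i x = a]) /\
  forall phi, finsupp phi ->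
    uniform_prob (@ltr01 R) [set x | forall i, phi i (X i x)] = (w phi)%:E.
  apply: exists_pattern_process.
  - exact: wt_ge0.
  - exact: wt_full.
  - exact: wt_empty.
  - exact: wt_split.
exists (fun i => X (chain i)); split; first by move=> i a; exact: mX.
- move=> u v u0; pose c := chain (u, v).
  have e : chain (u, v + u) = (c.1, c.2 + 1).
    by rewrite /c /chain /= -{3 5}[u]scale1r line_repD line_posD.
  (* both neighbours carry the letter a: a pattern of weight zero *)
  pose phi (a : 'I_4) (i : K * int) : pred 'I_4 :=
    fun b => ((i == c) || (i == (c.1, c.2 + 1))) ==> (b == a).
  have fphi a : finsupp (phi a).
    by exists [:: c; (c.1, c.2 + 1)] => i; rewrite !inE /phi => /negbTE -> b.
  have boxE a : [set x | X c x = X (c.1, c.2 + 1) x] `&` [set x | X c x = a] =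
      [set x | forall i, phi a i (X i x)].
    apply/seteqP; split => x /=.
      move=> [e1 e2] i; apply/implyP => /orP [/eqP ->|/eqP ->]; first by rewrite e2.
      by rewrite -e1 e2.
    move=> h; have /eqP h1 : X c x == a by have := h c; rewrite /phi eqxx.
    have /eqP h2 : X (c.1, c.2 + 1) x == a.
      by have := h (c.1, c.2 + 1); rewrite /phi eqxx orbT.
    by rewrite h1 h2.
  rewrite e -/c (@prob_partition _ _ _ _ _ _ (X c)) //; last first.
    rewrite (_ : [set _ | _] = \bigcup_a [set x | forall i, phi a i (X i x)]).
      by apply: countable_bigcupT_measurable => // a; exact: measurable_box.
    apply/seteqP; split => x /=.
      by move=> h; exists (X c x) => //; rewrite -boxE.
    by move=> [a _]; rewrite -boxE => -[].
  rewrite big1 // => a _; rewrite boxE [LHS]PX //; congr (_%:E).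
  apply: (wt_double p0 pD (k := c.1) (j := c.2) (a := a)) => //.
    by move=> b; rewrite /phi -surjective_pairing eqxx => /eqP.
  by move=> b; rewrite /phi eqxx orbT => /eqP.
- move=> S1 S2 ap E1 E2 h1 h2.
  move: (sigma_restr_boxes h1) (sigma_restr_boxes h2).
  move: E1 E2 {h1 h2}; apply: indep_pi.
  + exact: boxes_setI.
  + exact: boxes_setI.
  + by move=> E [phi [_ _ ->]]; exact: measurable_box.
  + by move=> E [phi [_ _ ->]]; exact: measurable_box.
  move=> E1 E2 [phi [fphi Sphi ->]] [psi [fpsi Spsi ->]].
  rewrite boxI [LHS]PX; last exact: finsuppI.
  rewrite [X in (X * _)%E]PX // [X in (_ * X)%E]PX // -EFinM; congr (_%:E).
  apply: (wtI p0 pD) => // k i j ij ji.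
  have [[[u v] Sv cv]|nS] := pselect ((@chain d @` S1) (k, i)); last by left; exact: Sphi.
  have [[[u' v'] Sv' cv']|nS] := pselect ((@chain d @` S2) (k, j)); last by right; exact: Spsi.
  have kk : (chain (u, v)).1 = (chain (u', v')).1 by rewrite cv cv'.
  have vi : line_pos u v = i by have := congr1 snd cv.
  have vj : line_pos u' v' = j by have := congr1 snd cv'.
  have [] := chain_apart kk; rewrite ?vi ?vj // => uu [m m1 vv].
  by move: Sv'; rewrite -uu => Sv'; have := ap u v v' m Sv Sv' m1; rewrite vv eqxx.
move=> t D hD.
pose G := [set E : set (V * V -> nat) | exists psi : V * V -> set nat, exists s : seq (V * V),
   (forall i, i \notin s -> psi i = setT) /\ E = [set z | forall i, psi i (z i)]].
have GD : <<s G >> D.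
  move: D hD; apply: sub_g_sigma_algebra => E [i _ [B _ <-]]; apply: sub_sigma_algebra.
  exists (fun l => [set b | l = i -> B b]), [:: i]; split.
    by move=> l; rewrite inE => /eqP li; apply/seteqP; split => b //= _ /li.
  rewrite setTI; apply/seteqP; split => z /=; first by move=> Bz l ->.
  by move=> /(_ i erefl).
pose sg := chain_tr t; pose sh := chain_sh t.
pose P : probability (measurableTypeR R) R := uniform_prob (@ltr01 R).
rewrite -[LHS]/(P _) -[RHS]/(P _).
pose f x (i : V * V) := X (chain (i.1, i.2 + t)) x : nat.
pose g x (i : V * V) := X (chain i) x : nat.
suff h : P (f @^-1` D `&` setT) = (1%:E * P (g @^-1` D))%E.
  by move: h; rewrite setIT mul1e.
apply: (@pi_lambda_eq _ _ _ P _ G f g setT 1) => //; rewrite ?probability_setT //.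
  move=> E F [phi [s [hs ->]]] [psi [r [hr ->]]].
  exists (fun i => phi i `&` psi i), (s ++ r); split.
    by move=> i; rewrite mem_cat negb_or => /andP [/hs -> /hr ->]; rewrite setIT.
  apply/seteqP; split => z /=; first by move=> [h1 h2] i; split.
  by move=> h; split => i; have [] := h i.
move=> E [psi [s [hs ->]]].
(* the pattern on chains that expresses psi, when the site i is placed at c i *)
pose phi (c : V * V -> K * int) (k : K * int) : pred 'I_4 :=
  fun a => `[< forall i, c i = k -> psi i a >].
have preE c : [set x | forall i, psi i (X (c i) x)] = [set x | forall k, phi c k (X k x)].
  apply/seteqP; split => x /= h; first by move=> k; apply/asboolP => i <-.
  by move=> i; have /asboolP := h (c i); exact.
have fphi c : finsupp (phi c).
  exists (map c s) => k ks a; apply/asboolP => i ik.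
  by rewrite hs //; apply: contra ks => si; rewrite -ik map_f.
have e1 : f @^-1` [set z | forall i, psi i (z i)] =
  [set x | forall k, phi (fun i => chain (i.1, i.2 + t)) k (X k x)] by exact: preE.
have e2 : g @^-1` [set z | forall i, psi i (z i)] =
  [set x | forall k, phi (@chain d) k (X k x)] by exact: preE.
rewrite e1 e2; split; [exact: measurable_box..|].
rewrite setIT mul1e [LHS]PX // [RHS]PX //; congr (_%:E).
apply: (wt_shift p0 pD (sg := sg) (sh := sh)) => //; first exact: chain_tr_inj.
  move=> k j; apply: funext => a; apply/asbool_equiv_eq; split => h i ik.
    by apply: h; case: i ik => u v; rewrite /= chain_shift => ->.
  apply: h; case: i ik => u v; rewrite /= chain_shift => -[/chain_tr_inj <- /addIr <-].
  exact: surjective_pairing.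
move=> k j nk a; apply/asboolP => -[u v] /=; rewrite chain_shift => -[kk _].
by case: nk; exists (chain (u, v)).1.
Qed.

End LineProcess.

(** * Factors of the line process *)
Section FiniteDependence.
Local Open Scope classical_set_scope.

Lemma g_sigma_algebraI (T : Type) (G : set (set T)) : setI_closed <<s G >>.
Proof.
have hC A : <<s G >> A -> <<s G >> (~` A).
  by rewrite -setTD; exact: sigma_algebraCD.
move=> A B sA sB; rewrite -(setCK (A `&` B)) setCI; apply: (hC).
rewrite -bigcup2E; apply: sigma_algebra_bigcup => -[|[|n]] /=; [exact: hC..|].
exact: sigma_algebra0.
Qed.

Definition depends_on (J : eqType) (s : seq J) (g : (J -> nat) -> nat) :=
  forall z z', {in s, z =1 z'} -> g z = g z'.

(** Induction on s: condition on the value at one coordinate, which takes countably many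
    values. *)
Lemma sigma_restr_dep (J : eqType) (T : Type) (z : J -> T -> nat) (S : set J)
    (s : seq J) (g : (J -> nat) -> nat) (B : set nat) :
  (forall j, j \in s -> S j) -> depends_on s g ->
  sigma_restr z S [set x | B (g (fun j => z j x))].
Proof.
elim: s g => [|j s IH] g sS gs.
  have gc x : g (fun j => z j x) = g (fun=> 0) by apply: gs => j.
  have [Bg|Bg] := pselect (B (g (fun=> 0))).
    rewrite (_ : [set _ | _] = ~` set0).
      by rewrite -setTD; apply: sigma_algebraCD; exact: sigma_algebra0.
    by apply/seteqP; split => x /=; [move=> _ []|rewrite gc].
  rewrite (_ : [set _ | _] = set0); first exact: sigma_algebra0.
  by apply/seteqP; split => x //=; rewrite gc.
pose upd n (y : J -> nat) l := if l == j then n else y l.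
rewrite (_ : [set _ | _] = \bigcup_n ([set x | z j x = n] `&`
    [set x | B (g (upd n (fun l => z l x)))])); last first.
  have e x : g (upd (z j x) (fun l => z l x)) = g (fun l => z l x).
    by congr g; apply: funext => l; rewrite /upd; case: eqP => [->|].
  apply/seteqP; split => x /=.
    by move=> Bx; exists (z j x) => //; split => //=; rewrite e.
  by move=> [n _ [/= <-]]; rewrite e.
apply: sigma_algebra_bigcup => n; apply: g_sigma_algebraI.
  apply: sub_sigma_algebra; exists j; first by apply: sS; rewrite mem_head.
  by exists [set n] => //; rewrite setTI.
apply: (IH (fun y => g (upd n y))).
  by move=> l ls; apply: sS; rewrite inE ls orbT.
move=> y y' yy; apply: gs => l; rewrite inE /upd; case: eqP => //= _; exact: yy.
Qed.

Lemma sigma_restr_preimage (V T : Type) (z : V -> T -> nat) (S : set V)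
   (U : Type) (h : U -> T) (G : set (set U)) :
  (forall v B, S v -> <<s G >> [set x | B (z v (h x))]) ->
  forall C, sigma_restr z S C -> <<s G >> (h @^-1` C).
Proof.
move=> hG; apply: smallest_sub; last first.
  by move=> C [v Sv [B _ <-]]; rewrite setTI; exact: hG.
split.
- by rewrite /= preimage_set0; exact: sigma_algebra0.
- by move=> A hA; rewrite setTD /= -preimage_setC -setTD; exact: sigma_algebraCD.
- by move=> F hF; rewrite /= preimage_bigcup; exact: sigma_algebra_bigcup.
Qed.

Lemma sigma_restr_measurable d (T : measurableType d) (V : Type) (z : V -> T -> nat) (S : set V) :
  (forall v n, measurable [set x | z v x = n]) -> sigma_restr z S `<=` measurable.
Proof.
move=> mz; apply: smallest_sub; first exact: sigma_algebra_measurable.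
move=> E [v _ [B _ <-]]; rewrite setTI.
rewrite (_ : _ @^-1` _ = \bigcup_(n in B) [set x | z v x = n]).
  by apply: bigcup_measurable => n _; exact: mz.
by apply/seteqP; split => x /=; [exists (z v x)|move=> [n Bn /= ->]].
Qed.

End FiniteDependence.

Section LatticePaths.
Local Open Scope ring_scope.
Variable d : nat.
Notation V := 'rV[int]_d.

Lemma l1norm_ge0 (v : V) : 0 <= l1norm v.
Proof. by apply: sumr_ge0. Qed.

(** The graph distance is at most the l1 distance: correct one coordinate at a time. *)
Lemma lattice_path (a b : V) : exists p : seq V,
  [/\ path (@lattice_adj d) a p, last a p = b & (size p)%:Z = l1norm (a - b)].
Proof.
have [n] : exists n : nat, l1norm (a - b) = n%:Z.
  by exists (absz (l1norm (a - b))); rewrite gez0_abs // l1norm_ge0.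
elim: n a => [|n IH] a ab.
  exists [::]; split => //=; apply/rowP => i.
  have /eqP := ab; rewrite psumr_eq0 // => /allP /(_ i (mem_index_enum _)).
  by rewrite !mxE normr_eq0 subr_eq0 => /eqP.
have [i ni] : exists i, a 0 i != b 0 i.
  apply/existsP; apply: contraPT isT; rewrite negb_exists => /forallP h.
  suff : l1norm (a - b) = 0 by rewrite ab.
  by apply: big1 => i _; rewrite !mxE; move: (h i); rewrite negbK => /eqP ->; rewrite subrr normr0.
pose s : int := if a 0 i < b 0 i then 1 else -1.
pose a' : V := a + s *: 'e_i.
have a'E j : a' 0 j = a 0 j + (if j == i then s else 0).
  by rewrite !mxE eqxx /=; case: eqP; rewrite ?mulr1 ?mulr0.
have sub (v w : V) j : (v - w) 0 j = v 0 j - w 0 j by rewrite !mxE.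
have adj : lattice_adj a a'.
  rewrite /lattice_adj /l1norm (bigD1 i) //= big1.
    by rewrite !mxE !eqxx /s; case: ifP => _; lia.
  by move=> j /negbTE ji; rewrite !mxE ji andbF mulr0 addr0 subrr normr0.
have a'b : l1norm (a' - b) = n%:Z.
  have : l1norm (a - b) = l1norm (a' - b) + 1.
    rewrite /l1norm (bigD1 i) //= [in RHS](bigD1 i) //= addrAC; congr (_ + _).
      by rewrite !sub a'E eqxx /s; move/eqP: ni; case: ifP; lia.
    by apply: eq_bigr => j /negbTE ji; rewrite !sub a'E ji addr0.
  by rewrite ab; lia.
have [p [pp lp sp]] := IH a' a'b.
exists (a' :: p); split => //=; first by rewrite adj.
by rewrite -addn1 PoszD sp a'b ab; lia.
Qed.

Lemma dist_gt_l1 k (A B : set V) a b : dist_gt (@lattice_adj d) k A B ->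
  A a -> B b -> k%:Z < l1norm (a - b).
Proof.
move=> h Aa Bb; have [p [pp lp <-]] := lattice_path a b.
by have := h a b p Aa Bb pp lp.
Qed.

End LatticePaths.

Section FactorOfLines.
Local Open Scope classical_set_scope.
Local Open Scope ring_scope.
Variable d : nat.
Notation V := 'rV[int]_d.
Variables (U : seq V).

(** The values at v along the directions of U, packed into one number below 4 ^ size U. *)
Definition digits (z : V * V -> nat) (v : V) : nat :=
  foldr (fun u n => z (u, v) + 4 * n)%N 0%N U.

Lemma digits_lt z v : (forall i, z i < 4)%N -> (digits z v < 4 ^ size U)%N.
Proof.
move=> z4; rewrite /digits; elim: U => //= u s IH.
by rewrite expnS; have := z4 (u, v); lia.
Qed.

Lemma digits_inj z v v' u : (forall i, z i < 4)%N -> u \in U ->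
  digits z v = digits z v' -> z (u, v) = z (u, v').
Proof.
move=> z4; rewrite /digits; elim: U => //= u' s IH.
rewrite inE => us e.
have [e1 e2] : z (u', v) = z (u', v') /\
    foldr (fun u n => z (u, v) + 4 * n)%N 0%N s = foldr (fun u n => z (u, v') + 4 * n)%N 0%N s.
  by have := z4 (u', v); have := z4 (u', v'); lia.
by case/orP: us => [/eqP -> //|us]; exact: IH.
Qed.

Lemma digits_dep v z z' : (forall u, u \in U -> z (u, v) = z' (u, v)) ->
  digits z v = digits z' v.
Proof.
rewrite /digits; elim: U => //= u s IH h; rewrite h ?mem_head // IH // => u' us.
by apply: h; rewrite inE us orbT.
Qed.

Variables (W : seq V) (F : (V -> nat) -> nat) (k q : nat).
Hypothesis U_neq0 : forall u, u \in U -> u != 0.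
Hypothesis F_dep : depends_on W F.
Hypothesis F_lt : forall y, (F y < q)%N.
Hypothesis F_proper : forall y, (forall v, y v < 4 ^ size U)%N ->
  (forall u v, u \in U -> y v <> y (v + u)) ->
  forall v v', lattice_adj v v' -> F (fun w => y (v + w)) <> F (fun w => y (v' + w)).
Hypothesis F_range : forall a b w w' u (m : int), w \in W -> w' \in W -> u \in U ->
  `|m| <= 1 -> a + w = b + w' + m *: u -> l1norm (a - b) <= k%:Z.

(** A local, translation-equivariant rule F applied to the packed colours of the lines
    gives a stationary k-dependent q-colouring, as soon as it yields proper colourings from
    labels that differ along U and its window is small compared to k. *)
Theorem factor_coloring (R : realType) : exists_stationary_dependent_coloring R d k q.
Proof.
have [Z [mZ Z_neq Z_ind Z_tr]] := @exists_line_process R d.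
set P : probability _ R := uniform_prob _ in Z_neq Z_ind Z_tr.
set Zn := fun i x => Z i x : nat in Z_ind Z_tr.
have Zn4 x i : (Zn i x < 4)%N by exact: ltn_ord.
pose G (v : V) (z : V * V -> nat) := (F (fun w => digits z (v + w)%R)).+1.
pose s v := [seq (u, v + w) | u <- U, w <- W].
have G_dep v : depends_on (s v) (G v).
  move=> z z' zz; congr _.+1; apply: F_dep => w Ww; apply: digits_dep => u Uu.
  by apply: zz; apply/allpairsP; exists (u, w).
have mZn i n : measurable [set x | Zn i x = n].
  have [n4|n4] := ltnP n 4.
    rewrite (_ : [set _ | _] = [set x | Z i x = Ordinal n4]) //.
    by apply/seteqP; split => x /= h; [exact: val_inj|rewrite /Zn h].
  rewrite (_ : [set _ | _] = set0) //; apply/seteqP; split => x //= h.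
  by move: (Zn4 x i); rewrite h ltnNge n4.
have mX v : measurable_fun setT (fun x => G v (fun i => Zn i x)).
  move=> _ B _; rewrite setTI.
  apply: (@sigma_restr_measurable _ _ _ Zn setT) => //.
  exact: (sigma_restr_dep B _ (G_dep v)).
pose X v : {RV P >-> nat} :=
  MeasurableFun.Pack (MeasurableFun.Class (isMeasurableFun.Build _ _ _ _ _ (mX v))).
exists _, _, P, X; split.
- split; first by move=> v x; rewrite /= F_lt.
  have : {ae P, forall x, forall n, if unpickle n is Some i then
       i.1 != 0 -> Z (i.1 : V, i.2 : V) x <> Z (i.1, i.2 + i.1) x else True}.
    apply: ae_foralln => n; case: unpickle => [[u v]|]; last exact: aeW.
    have [->|u0] := eqVneq u 0; first by apply: aeW => x /= /eqP.
    exists [set x | Z (u, v) x = Z (u, v + u) x]; split.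
    + rewrite (_ : [set _ | _] = \bigcup_a ([set x | Z (u, v) x = a] `&` [set x | Z (u, v + u) x = a])).
        by apply: countable_bigcupT_measurable => // a; exact: measurableI.
      apply/seteqP; split => x /=; first by move=> h; exists (Z (u, v) x).
      by move=> [a _ /= [-> ->]].
    + exact: Z_neq.
    + by move=> x /= h; apply: contrapT => h'; apply: h => _.
  apply: filterS => x h v v' vv; apply/eqP; rewrite /= /G eqSS; apply/eqP.
  apply: F_proper vv; first by move=> w; apply: digits_lt.
  move=> u w Uu e; have := h (pickle (u, w)); rewrite pickleK /=.
  move=> /(_ (U_neq0 Uu)); apply; apply: val_inj.
  exact: (digits_inj (Zn4 x) Uu e).
- move=> A B AB.
  have sub (S : set V) : sigma_restr X S `<=`
     sigma_restr Zn [set i | exists2 v, S v & i \in s v].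
    apply: sub_g_sigma_algebra => E [v Sv [C _ <-]]; rewrite setTI.
    apply: (sigma_restr_dep C _ (G_dep v)) => i si; by exists v.
  move=> E1 E2 /sub h1 /sub h2; apply: Z_ind h1 h2.
  move=> u v v' m [a Aa /allpairsP [[u1 w] /= [Uu Ww [e1 ->]]]].
  move=> [b Bb /allpairsP [[u2 w'] /= [_ Ww' [_ ->]]]] m1; apply/eqP => e.
  have := F_range Ww Ww' Uu m1; rewrite -e1 => /(_ _ _ e).
  by rewrite leNgt (dist_gt_l1 AB).
- move=> t C hC.
  pose D := [set z | C (fun v => G v z)].
  have hD : sigma_restr (fun i (z : V * V -> nat) => z i) setT D.
    apply: (@sigma_restr_preimage _ _ (fun v x => x v) setT _ (fun z v => G v z) _ _ C hC).
    by move=> v B _; apply: (sigma_restr_dep B _ (G_dep v)).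
  have := Z_tr t D hD.
  rewrite (_ : [set x | D (fun i => Zn i x)] = [set w | C (fun v => X v w)]) //.
  move=> <-; congr (P _).
  have eG x : (fun v => G v (fun i => Zn (i.1, i.2 + t) x)) = (fun v => X (v + t) x : nat).
    apply: funext => v; congr (F _).+1; apply: funext => w.
    by rewrite (addrAC v t w).
  by apply/seteqP; split => x; rewrite /D /= eG.
Qed.

End FactorOfLines.

(** * A local rule producing four colours *)
(** Two finite sets that differ in exactly one element have cardinalities of opposite
    parity. *)
Lemma parity_symdiff (T : eqType) (C C' : seq T) : uniq C -> uniq C' ->
  (forall u u', (u \in C) != (u \in C') -> (u' \in C) != (u' \in C') -> u = u') ->
  odd (size C) = odd (size C') -> C =i C'.
Proof.
move=> uC uC' h par.
have main (D D' : seq T) u : uniq D -> uniq D' ->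
    (forall u', (u' \in D) != (u' \in D') -> u = u') ->
    u \in D -> u \notin D' -> size D = (size D').+1.
  move=> uD uD' h' uin uout; suff : perm_eq D (u :: D') by move/perm_size.
  apply: uniq_perm => //; first by rewrite /= uout.
  move=> x; rewrite inE; have [->|xu] := eqVneq x u; first by rewrite uin.
  by apply/eqP; apply: contraT => /h' ux; rewrite ux eqxx in xu.
move=> x; apply/eqP; apply: contraT => hx.
have hx' u' : (u' \in C) != (u' \in C') -> x = u' by exact: h.
case: (boolP (x \in C)) (hx) => xC; case: (boolP (x \in C')) => xC' // _.
  by move: par; rewrite (main C C' x) //= => /esym; case: (odd _).
have hs u' : (u' \in C') != (u' \in C) -> x = u' by rewrite eq_sym; exact: h.
by move: par; rewrite (main C' C x) //=; case: (odd _).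
Qed.

Lemma lattice_adj_step d (v v' : 'rV[int]_d) : lattice_adj v v' ->
  exists i, (v' = v + 'e_i \/ v = v' + 'e_i)%R.
Proof.
rewrite /lattice_adj /l1norm => /eqP h.
have [i hi] : exists i, v 0%R i != v' 0%R i.
  apply/existsP; apply: contraPT isT; rewrite negb_exists => /forallP hv.
  move: h; rewrite big1 // => j _.
  by move: (hv j); rewrite !mxE negbK => /eqP ->; rewrite subrr normr0.
have e0 (j : 'I_d) : j != i -> v 0%R j = v' 0%R j.
  move=> ji; move: h; rewrite (bigD1 i) //= (bigD1 j) //= !mxE.
  have : (0 <= \sum_(k < d | (k != i) && (k != j)) `|(v - v') 0 k|)%R by exact: sumr_ge0.
  move: (bigop _ _ _) => S; move: hi.
  by move: (v 0%R i) (v' 0%R i) (v 0%R j) (v' 0%R j) => a b c e; lia.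
have e1 : (`|v 0 i - v' 0 i| = 1)%R.
  move: h; rewrite (bigD1 i) //= !mxE big1 ?addr0 // => j /e0.
  by rewrite !mxE => ->; rewrite subrr normr0.
exists i; have [h1|h1] : (v' 0 i = v 0 i + 1 \/ v 0 i = v' 0 i + 1)%R.
  by move: e1; move: (v 0%R i) (v' 0%R i) => a b; lia.
- left; apply/rowP => j; rewrite !mxE eqxx /=.
  by have [->|/e0 ->] := eqVneq j i; rewrite ?h1 ?addr0.
- right; apply/rowP => j; rewrite !mxE eqxx /=.
  by have [->|/e0 ->] := eqVneq j i; rewrite ?h1 ?addr0.
Qed.

Section LocalRule.
Local Open Scope ring_scope.
Variables (d : nat).
Notation V := 'rV[int]_d.
Implicit Types (v w u : V) (D n r : nat) (y : V -> nat).

Definition sup_ball D : seq V := undup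
  [seq \row_i ((f i : nat)%:Z - D%:Z) | f : {ffun 'I_d -> 'I_(D.*2.+1)}].

Lemma sup_ballP D w : reflect (forall i, (absz (w 0%R i) <= D)%N) (w \in sup_ball D).
Proof.
rewrite mem_undup; apply: (iffP mapP) => [[f _ ->] i|h].
  by rewrite !mxE; move: (nat_of_ord (f i)) (ltn_ord (f i)) => m; lia.
exists [ffun i => inord (absz (w 0 i + D%:Z)%R)]; first by rewrite mem_enum.
by apply/rowP => i; rewrite mxE ffunE; move: (w 0 i) (h i) => x hx; rewrite inordK; lia.
Qed.

Lemma sup_ball_opp D w : w \in sup_ball D -> - w \in sup_ball D.
Proof. by move=> /sup_ballP h; apply/sup_ballP => i; rewrite mxE abszN. Qed.

Lemma sup_ballD D D' w w' : w \in sup_ball D -> w' \in sup_ball D' -> w + w' \in sup_ball (D + D').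
Proof.
move=> /sup_ballP h /sup_ballP h'; apply/sup_ballP => i; rewrite mxE.
by move: (w 0 i) (w' 0 i) (h i) (h' i) => a b; lia.
Qed.

Lemma sup_ball_le D D' w : (D <= D')%N -> w \in sup_ball D -> w \in sup_ball D'.
Proof. by move=> DD /sup_ballP h; apply/sup_ballP => i; have := h i; lia. Qed.

Lemma sup_ball0 D : 0 \in sup_ball D.
Proof. by apply/sup_ballP => i; rewrite mxE. Qed.

Variables (rho Q : nat).

(** Two boxes of radii r and r', the centre of the second being w as seen from the centre of
    the first, have faces in a common hyperplane orthogonal to some axis. *)
Definition clash r w r' : bool := [exists i : 'I_d,
  (r == absz (w 0 i + r'%:Z)%R) || (r == absz (w 0 i - r'%:Z)%R)].

(** Greedy selection: the vertices labelled n' are treated at stage n'.+1, knowing the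
    choices made for smaller labels.  The value is None as long as v is not a centre.  Doing
    this by recursion on the labels makes the outcome depend on a bounded window only. *)
Fixpoint radius n y v : option nat :=
  if n is n'.+1 then
    if y v == n' then
      if has (fun w => radius n' y (v + w) != None) (sup_ball rho.-1) then None
      else Some (head 0%N [seq r <- iota rho rho |
        all (fun w => if radius n' y (v + w) is Some r' then ~~ clash r w r' else true)
            (sup_ball (4 * rho))])
    else radius n' y v
  else None.

Lemma radius_local n y y' v v' :
  (forall w, w \in sup_ball (n * (4 * rho)) -> y (v + w) = y' (v' + w)) ->
  radius n y v = radius n y' v'.
Proof.
elim: n v v' => //= n IH v v' h.
have hw w : w \in sup_ball (4 * rho) -> radius n y (v + w) = radius n y' (v' + w).
  move=> wb; apply: IH => x xb; rewrite -!addrA; apply: h.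
  by rewrite mulSn; exact: sup_ballD.
have h0 : radius n y v = radius n y' v'.
  by rewrite -[v]addr0 -[v']addr0; apply: hw; exact: sup_ball0.
have -> : y v = y' v' by rewrite -[v]addr0 -[v']addr0 h ?sup_ball0.
case: ifP => // _.
have -> : has (fun w => radius n y (v + w) != None) (sup_ball rho.-1) =
          has (fun w => radius n y' (v' + w) != None) (sup_ball rho.-1).
  by apply: eq_in_has => w wb; rewrite hw //; apply: sup_ball_le wb; lia.
case: ifP => // _; congr (Some (head _ _)); apply: eq_filter => r.
by apply: eq_in_all => w wb; rewrite hw.
Qed.

Lemma radius_early n y v : (n <= y v)%N -> radius n y v = None.
Proof.
elim: n => //= n IH nv; have -> : (y v == n) = false by lia.
by apply: IH; lia.
Qed.

Lemma radius_late n y v : (y v < n)%N -> radius n y v = radius (y v).+1 y v.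
Proof.
elim: n => // n IH vn; have [->//|nv] := eqVneq (y v) n.
have -> : radius n.+1 y v = radius n y v by rewrite /= (negbTE nv).
by apply: IH; lia.
Qed.

(** The centres, seen from v, whose box contains v.  The box of a centre u with radius r is the
    set of the v such that - r <= v i - u i < r for all i. *)
Definition cover y v : seq V := [seq w <- sup_ball (2 * rho) |
  if radius Q y (v + w) is Some r
  then [forall i : 'I_d, - r%:Z < w 0 i <= r%:Z] else false].

Definition root_colour y v : nat :=
  find (fun c => c \in [seq y (v + w) | w <- cover y v]) (iota 0 Q).

(** The filter leaves a single centre, the root (see [root_parityE]). *)
Definition root_parity y v : bool := odd (absz
  (\sum_(w <- [seq w <- cover y v | y (v + w) == root_colour y v]) \sum_i w 0 i)%R).

Definition colour y v : nat := (odd (size (cover y v))).*2 + root_parity y v.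

Definition reach : nat := Q * (4 * rho) + 2 * rho.

(** The colour at v is determined, in a translation-equivariant way, by the labels in a window
    around v: this gives both the locality and the equivariance of the rule. *)
Lemma colour_local y y' v v' :
  (forall w, w \in sup_ball reach -> y (v + w) = y' (v' + w)) -> colour y v = colour y' v'.
Proof.
move=> h.
have hy w : w \in sup_ball (2 * rho) -> y (v + w) = y' (v' + w).
  by move=> wb; apply: h; apply: sup_ball_le wb; rewrite leq_addl.
have hc : cover y v = cover y' v'.
  apply: eq_in_filter => w wb; rewrite (@radius_local Q y y' (v + w) (v' + w)) // => x xb.
  by rewrite -!addrA; apply: h; rewrite /reach addnC; exact: sup_ballD.
have cb w : w \in cover y' v' -> w \in sup_ball (2 * rho) by rewrite mem_filter => /andP [].
have hr : root_colour y v = root_colour y' v'.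
  rewrite /root_colour hc; apply: eq_find => c; congr (_ \in _).
  by apply/eq_in_map => w /cb /hy.
rewrite /colour /root_parity hc hr; congr (_ + _)%N; congr (odd (absz _) : nat).
rewrite -[in LHS](@eq_in_filter _ (fun w => y' (v' + w) == root_colour y' v')) //.
by move=> w /cb /hy ->.
Qed.

Lemma colour_lt y v : (colour y v < 4)%N.
Proof. by rewrite /colour; case: (odd _); case: (root_parity _ _). Qed.

Section Coloured.
Hypothesis rho_big : (2 * d * 9 ^ d < rho)%N.
Variable y : V -> nat.
Hypothesis y_lt : forall v, (y v < Q)%N.
Hypothesis y_neq : forall v w, w \in sup_ball (4 * rho) -> w != 0 -> y v != y (v + w).

Let rad := radius Q y.

Lemma radius_stage n v : radius n y v = if (y v < n)%N then rad v else None.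
Proof.
case: ltnP => h; last exact: radius_early.
by rewrite /rad !(@radius_late _ y v).
Qed.

Lemma radE v : rad v =
  if has (fun w => (y (v + w) < y v)%N && (rad (v + w) != None)) (sup_ball rho.-1) then None
  else Some (head 0%N [seq r <- iota rho rho |
        all (fun w => if radius (y v) y (v + w) is Some r' then ~~ clash r w r' else true)
            (sup_ball (4 * rho))]).
Proof.
rewrite /rad (@radius_late Q) //= eqxx -/rad.
have -> : has (fun w => radius (y v) y (v + w) != None) (sup_ball rho.-1) =
   has (fun w => (y (v + w)%R < y v)%N && (rad (v + w) != None)) (sup_ball rho.-1).
  by apply: eq_has => w; rewrite radius_stage; case: ifP.
by [].
Qed.

Lemma rad_covering v : exists2 w, w \in sup_ball rho.-1 & rad (v + w) != None.
Proof.
have := radE v; case: hasP => [[w wb /andP [_ h]] _|_ e]; first by exists w.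
by exists 0; rewrite ?sup_ball0 // addr0 e.
Qed.

Lemma rad_lower v w : w \in sup_ball rho.-1 -> (y (v + w) < y v)%N ->
  rad (v + w) != None -> rad v = None.
Proof.
by move=> wb lt h; rewrite radE; case: hasP => // -[]; exists w; rewrite ?lt.
Qed.

Lemma rad_apart v w : w \in sup_ball rho.-1 -> rad v != None -> rad (v + w) != None -> w = 0.
Proof.
move=> wb hv hw; apply/eqP; apply: contraT => w0.
have wb4 : w \in sup_ball (4 * rho) by apply: sup_ball_le wb; lia.
have := y_neq v wb4 w0; rewrite neq_ltn => /orP [lt|gt].
  have := @rad_lower (v + w) (- w) (sup_ball_opp wb); rewrite addrK => /(_ lt hv) h.
  by rewrite h in hw.
by rewrite (rad_lower wb gt hw) in hv.
Qed.

(** A box of radius 4 rho is covered by 9 ^ d cells of side rho, each of which contains at most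
    one centre. *)
Lemma radius_packing n v :
  (size [seq w <- sup_ball (4 * rho) | radius n y (v + w) != None] <= 9 ^ d)%N.
Proof.
set C := [seq w <- _ | _]; have rho0 : (0 < rho)%N by lia.
pose cell w : {ffun 'I_d -> 'I_9} := [ffun i => inord (absz (w 0 i + (4 * rho)%:Z)%R %/ rho)].
have uC : uniq C by rewrite filter_uniq // undup_uniq.
have near w : w \in C -> rad (v + w) != None /\ w \in sup_ball (4 * rho).
  by rewrite mem_filter radius_stage => /andP []; case: ifP.
have inj : {in C &, injective cell}.
  move=> w w' /near [hw /sup_ballP wb] /near [hw' /sup_ballP wb'] e.
  suff w0 : w' - w = 0 by apply/eqP; rewrite eq_sym -subr_eq0 w0.
  apply: (@rad_apart (v + w) (w' - w)) => //; last by rewrite addrA addrAC addrK.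
  apply/sup_ballP => i; have := congr1 (fun f : {ffun 'I_d -> 'I_9} => f i : nat) e.
  rewrite !mxE !ffunE; move: (w 0 i) (w' 0 i) (wb i) (wb' i) => a b ha hb.
  rewrite !inordK; try by rewrite ltn_divLR //; lia.
  move=> ab; have := divn_eq (absz (a + (4 * rho)%:Z)%R) rho; rewrite ab.
  have := divn_eq (absz (b + (4 * rho)%:Z)%R) rho.
  have := ltn_pmod (absz (a + (4 * rho)%:Z)%R) rho0.
  have := ltn_pmod (absz (b + (4 * rho)%:Z)%R) rho0.
  by move: (_ %/ _ * _)%N (_ %% _)%N (_ %% _)%N => c r s; lia.
have : uniq (map cell C) by rewrite (map_inj_in_uniq inj).
move/card_uniqP; rewrite size_map => <-; apply: leq_trans (max_card _) _.
by rewrite card_ffun !card_ord.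
Qed.

(** Each of the at most 9 ^ d nearby centres excludes two radii for each axis, and there are rho
    candidates. *)
Lemma exists_radius n v : has (fun r =>
    all (fun w => if radius n y (v + w) is Some r' then ~~ clash r w r' else true)
        (sup_ball (4 * rho))) (iota rho rho).
Proof.
apply: contraT => /hasPn h; set C := [seq w <- sup_ball (4 * rho) | radius n y (v + w) != None].
(* the radii excluded by the nearby centres, two for each centre and axis *)
pose bad := [seq absz (w 0 ib.1 + (if ib.2 then 1 else -1) * (odflt 0%N (radius n y (v + w)))%:Z)%R
   | w <- C, ib <- enum (('I_d * bool)%type : finType)].
have sub : {subset iota rho rho <= bad}.
  move=> r /h /allPn [w wb]; case e: (radius n y (v + w)) => [r'|//].
  rewrite negbK => /existsP [i hi].
  have wC : w \in C by rewrite mem_filter e.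
  apply/allpairsP; exists (w, (i, r == absz (w 0 i + r'%:Z)%R)); split => //=; first by rewrite mem_enum.
  rewrite e /=; case: eqP hi => [-> _|_ /eqP ->]; [by rewrite mul1r|by rewrite mulN1r].
have := uniq_leq_size (iota_uniq rho rho) sub; rewrite size_iota size_allpairs.
rewrite -cardE card_prod card_ord card_bool.
have := radius_packing n v; rewrite -/C => hC hr.
suff : (rho <= 2 * d * 9 ^ d)%N by lia.
apply: (leq_trans hr); rewrite mulnC (mulnC d); exact: leq_mul.
Qed.

Lemma rad_spec v r : rad v = Some r -> (rho <= r < 2 * rho)%N /\
  forall w r', w \in sup_ball (4 * rho) -> (y (v + w) < y v)%N ->
    rad (v + w) = Some r' -> ~~ clash r w r'.
Proof.
rewrite radE; case: ifP => // _ [].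
set p := (X in seq.filter X _); have := exists_radius (y v) v.
rewrite -/p has_filter; case e : (seq.filter p _) => [//|r0 s] _ /= <-.
have : r0 \in seq.filter p (iota rho rho) by rewrite e mem_head.
rewrite mem_filter mem_iota => /andP [/allP pr hr]; split; first by lia.
by move=> w r' /pr; rewrite radius_stage => h lt e'; move: h; rewrite lt e'.
Qed.

Lemma clashC r w r' : clash r w r' = clash r' (- w) r.
Proof.
apply/existsP/existsP => -[i h]; exists i; move: h; rewrite mxE;
  by move: (w 0 i) => a; lia.
Qed.

(** Of two nearby centres, the one with the larger label took the other into account. *)
Lemma rad_no_clash v w r r' : w \in sup_ball (4 * rho) -> w != 0 ->
  rad v = Some r -> rad (v + w) = Some r' -> ~~ clash r w r'.
Proof.
move=> wb w0 hr hr'; have := y_neq v wb w0; rewrite neq_ltn => /orP [lt|gt].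
  rewrite clashC; apply: (rad_spec hr').2; [exact: sup_ball_opp|by rewrite addrK..].
exact: (rad_spec hr).2.
Qed.

Definition centres v : seq V := [seq v + w | w <- cover y v].

Lemma uniq_centres v : uniq (centres v).
Proof. by rewrite map_inj_uniq ?filter_uniq ?undup_uniq //; exact: addrI. Qed.

Lemma centresP v u : reflect (exists2 r, rad u = Some r &
    forall i, - r%:Z < u 0 i - v 0 i <= r%:Z) (u \in centres v).
Proof.
apply: (iffP mapP) => [[w]|[r ur h]].
  rewrite mem_filter -/rad => /andP [+ _] ->; case e: (rad (v + w)) => [r|//] /forallP h.
  by exists r => // i; rewrite mxE addrAC subrr add0r.
exists (u - v); last by rewrite addrC subrK.
rewrite mem_filter -/rad addrC subrK ur; apply/andP; split.
  by apply/forallP => i; rewrite !mxE.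
have [/andP [r1 r2] _] := rad_spec ur.
by apply/sup_ballP => i; rewrite !mxE; move: (h i); move: (u 0 i - v 0 i) => a; lia.
Qed.

(** Two boxes that contain v have their centres within distance 4 rho, where labels are
    distinct. *)
Lemma centres_colour_inj v u u' : u \in centres v -> u' \in centres v ->
  y u = y u' -> u = u'.
Proof.
move=> /centresP [r ur h] /centresP [r' ur' h'] e; apply/eqP; apply: contraT => uu.
have := @y_neq u (u' - u); rewrite [u + _]addrC subrK e eqxx => h0.
suff : ~~ true by [].
apply: h0; last by rewrite subr_eq0 eq_sym.
have [/andP [r1 r2] _] := rad_spec ur; have [/andP [r1' r2'] _] := rad_spec ur'.
apply/sup_ballP => i; move: (h i) (h' i); rewrite !mxE.
by move: (u 0 i) (u' 0 i) (v 0 i) => a b c; lia.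
Qed.

(** The covering property provides a box around v, hence a root: a centre whose label is the
    least one. *)
Lemma root_exists v : exists2 u, u \in centres v & y u = root_colour y v.
Proof.
have e : [seq y (v + w) | w <- cover y v] = map y (centres v) by rewrite -map_comp.
have [w wb hw] := rad_covering v; case er : (rad (v + w)) hw => [r|//] _.
have [/andP [r1 r2] _] := rad_spec er.
have wc : v + w \in centres v.
  apply/centresP; exists r => // i; rewrite mxE addrAC subrr add0r.
  by move/sup_ballP: wb => /(_ i); move: (w 0 i) => a; lia.
have hs : has (fun c => c \in [seq y (v + w) | w <- cover y v]) (iota 0 Q).
  apply/hasP; exists (y (v + w)); first by rewrite mem_iota y_lt.
  by rewrite e map_f.
have := nth_find 0%N hs; rewrite -/(root_colour y v) nth_iota; last first.
  by rewrite -[X in (_ < X)%N](size_iota 0 Q) -has_find.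
by rewrite add0n e => /mapP [u uc ->]; exists u.
Qed.

Lemma root_parityE v u : u \in centres v -> y u = root_colour y v ->
  root_parity y v = odd (absz (\sum_i (u 0 i - v 0 i))%R).
Proof.
move=> uc yu; have [w wc uw] := mapP uc.
rewrite /root_parity (_ : [seq w <- _ | _] = [:: w]).
  rewrite big_seq1 uw; congr (odd (absz _)); apply: eq_bigr => i _.
  by rewrite mxE addrAC subrr add0r.
apply: perm_small_eq => //; apply: uniq_perm => //.
  by rewrite filter_uniq // filter_uniq // undup_uniq.
move=> x; rewrite mem_filter inE; apply/andP/eqP => [[/eqP yx xc]|->]; last first.
  by rewrite -uw yu.
apply: (addrI v); rewrite -uw; apply: (@centres_colour_inj v) => //; first exact: map_f.
by rewrite yx yu.
Qed.

Lemma eq_root_colour v v' : centres v =i centres v' -> root_colour y v = root_colour y v'.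
Proof.
move=> cc; apply: eq_find => c.
have e x : [seq y (x + w) | w <- cover y x] = map y (centres x) by rewrite -map_comp.
by rewrite !e; exact: eq_mem_map.
Qed.

(** If the edge from v to v + e_i crosses the boundary of a box, then the coordinate i of v + e_i
    lies on one of the two hyperplanes that bound the box in this direction.  For two
    distinct boxes this would be a clash. *)
Lemma one_crossing v i u u' :
  (u \in centres v) != (u \in centres (v + 'e_i)) ->
  (u' \in centres v) != (u' \in centres (v + 'e_i)) -> u = u'.
Proof.
have eE j : (v + 'e_i) 0 j = v 0 j + (j == i)%:R by rewrite !mxE eqxx.
have inE v0 x r : rad x = Some r ->
    (x \in centres v0) = [forall j, - r%:Z < x 0 j - v0 0 j <= r%:Z].
  move=> xr; apply/centresP/forallP => [[r' xr' h] j|h]; last by exists r.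
  by have := h j; move: xr'; rewrite xr => -[<-].
have face x : (x \in centres v) != (x \in centres (v + 'e_i)) ->
    exists2 r, rad x = Some r & absz (x 0 i - v 0 i - 1)%R = r /\
      forall j, (absz (x 0 j - v 0 j)%R <= r.+1)%N.
  case e : (rad x) => [r|]; last first.
    have nc v0 : x \notin centres v0 by apply/centresP => -[r]; rewrite e.
    by rewrite (negbTE (nc _)) (negbTE (nc _)).
  rewrite !(inE _ _ _ e) => h; exists r => //.
  have out (a b : V) : (forall j, j != i -> a 0 j = b 0 j) ->
     [forall j, - r%:Z < x 0 j - a 0 j <= r%:Z] ->
     ~~ [forall j, - r%:Z < x 0 j - b 0 j <= r%:Z] ->
     (forall j, - r%:Z < x 0 j - a 0 j <= r%:Z) /\ ~~ (- r%:Z < x 0 i - b 0 i <= r%:Z).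
    move=> ab /forallP ha; rewrite negb_forall => /existsP [j hj]; split=> //.
    by have [<-//|ji] := eqVneq j i; move: hj; rewrite -ab // ha.
  have ve j : j != i -> v 0 j = (v + 'e_i) 0 j by move=> /negbTE ji; rewrite eE ji addr0.
  case: (boolP [forall j, _]) h => h1; case: (boolP [forall j, _]) => h2 // _.
    have [ha] := out _ _ ve h1 h2; rewrite eE eqxx => hb; split.
      by have := ha i; move: hb; move: (x 0 i) (v 0 i) => a b; lia.
    by move=> j; have := ha j; move: (x 0 j) (v 0 j) => a b; lia.
  have [|ha hb] := out _ _ _ h2 h1; first by move=> j ji; rewrite ve.
  split.
    have := ha i; move: hb; rewrite eE eqxx; move: (x 0 i) (v 0 i) => a b; lia.
  move=> j; have := ha j; rewrite eE; move: (x 0 j) (v 0 j) => a b.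
  by case: (j == i); lia.
move=> /face [r ur [hi hr]] /face [r' ur' [hi' hr']].
apply/eqP; apply: contraT => uu.
have [/andP [r1 r2] _] := rad_spec ur; have [/andP [r1' r2'] _] := rad_spec ur'.
have := @rad_no_clash u (u' - u) r r'; rewrite [u + _]addrC subrK => /(_ _ _ ur ur') h.
suff : ~~ clash r (u' - u) r'.
  move/existsP; case; exists i; rewrite !mxE.
  by move: hi hi'; move: (u 0 i) (u' 0 i) (v 0 i) => a b c; lia.
apply: h; last by rewrite subr_eq0 eq_sym.
apply/sup_ballP => j; rewrite !mxE; move: (hr j) (hr' j).
by move: (u 0 j) (u' 0 j) (v 0 j) => a b c; lia.
Qed.

(** If the numbers of boxes around the two ends have the same parity, then the boxes are the same
    by [one_crossing] and [parity_symdiff].  The ends then share their root, relative to which the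
    coordinate sum changes by one. *)
Lemma colour_step v i : colour y v != colour y (v + 'e_i).
Proof.
apply/eqP => e; set v' := v + 'e_i in e.
have [par rpar] : odd (size (cover y v)) = odd (size (cover y v')) /\
    root_parity y v = root_parity y v'.
  by move: e; rewrite /colour; do 2 case: (odd _); do 2 case: (root_parity _ _).
have cc : centres v =i centres v'.
  apply: parity_symdiff; [exact: uniq_centres..| |by rewrite !size_map].
  by move=> u u'; exact: one_crossing.
have [u uc yu] := root_exists v.
have uc' : u \in centres v' by rewrite -cc.
have yu' : y u = root_colour y v' by rewrite yu; exact: eq_root_colour.
move: rpar; rewrite (root_parityE uc yu) (root_parityE uc' yu').
have -> : \sum_j (u 0 j - v 0 j) = \sum_j (u 0 j - v' 0 j) + 1.
  rewrite (bigD1 i) //= [in RHS](bigD1 i) //= [RHS]addrAC; congr (_ + _).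
    by rewrite /v' !mxE !eqxx /=; move: (u 0 i) (v 0 i) => a b; lia.
  by apply: eq_bigr => j /negbTE ji; rewrite /v' !mxE ji andbF addr0.
by move: (\sum_j _) => a; lia.
Qed.

Lemma colour_proper v v' : lattice_adj v v' -> colour y v <> colour y v'.
Proof.
case/lattice_adj_step => i [->|->]; apply/eqP; last by rewrite eq_sym; exact: colour_step.
exact: colour_step.
Qed.

End Coloured.
End LocalRule.

(** * Conclusion *)
Section Conclusion.
Local Open Scope ring_scope.
Variable d : nat.
Notation V := 'rV[int]_d.

Lemma l1norm_sup_ball D (v : V) : v \in sup_ball d D -> l1norm v <= (d * D)%:Z.
Proof.
move=> /sup_ballP h; apply: (@le_trans _ _ (\sum_(i < d) D%:Z)).
  by apply: ler_sum => i _; rewrite -abszE lez_nat.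
by rewrite sumr_const card_ord -mulr_natl natz PoszM.
Qed.

Lemma sup_ball_line (D : nat) (u : V) (m : int) : `|m| <= 1 -> u \in sup_ball d D -> m *: u \in sup_ball d D.
Proof.
move=> m1 /sup_ballP h; apply/sup_ballP => i; rewrite !mxE abszM.
have : (absz m <= 1)%N by lia.
by case: (absz m) => [|[|//]] _; rewrite ?mul0n ?mul1n.
Qed.

(** Only lines parallel to the axes are used.  Vertices at distance greater than one are never
    equal or adjacent on such a line. *)
Theorem coloring_1_dependent (R : realType) :
  exists_stationary_dependent_coloring R d 1 (4 ^ d).
Proof.
pose U : seq V := [seq 'e_i | i : 'I_d].
have sU : size U = d by rewrite size_map -cardE card_ord.
(* the remainder only serves to bound the colour for arbitrary labels *)
apply: (@factor_coloring d U [:: 0] (fun y => y 0%R %% 4 ^ d)%N).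
- move=> u /mapP [i _ ->]; apply/eqP => /rowP /(_ i) /eqP.
  by rewrite !mxE !eqxx.
- by move=> y y' h; rewrite h // mem_head.
- by move=> y; rewrite ltn_mod expn_gt0.
- move=> y y4 yU v v' vv; rewrite !addr0 !modn_small -?sU //.
  have inU i : 'e_i \in U by apply: map_f; rewrite mem_enum.
  case/lattice_adj_step: vv => i [->|->]; first exact: yU.
  by move=> e; apply: (yU 'e_i v').
- move=> a b w w' u m; rewrite !inE => /eqP -> /eqP -> /mapP [i _ ->] m1.
  rewrite !addr0 => ->; rewrite addrAC subrr add0r /l1norm (bigD1 i) //= big1.
    by rewrite !mxE !eqxx mulr1 addr0.
  by move=> j /negbTE ji; rewrite !mxE ji andbF mulr0 normr0.
Qed.

Let rho := (2 * d * 9 ^ d).+1%N.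
Let U : seq V := [seq u <- sup_ball d (4 * rho) | u != 0].
Let Q := (4 ^ size U)%N.
Let K := reach rho Q.

(** The local rule is applied to labels that are distinct within sup distance 4 rho. *)
Theorem coloring_4 (R : realType) :
  exists_stationary_dependent_coloring R d (d * (2 * K + 4 * rho)) 4.
Proof.
have rho_big : (2 * d * 9 ^ d < rho)%N by [].
apply: (@factor_coloring d U (sup_ball d K) (fun y => colour rho Q y 0)).
- by move=> u; rewrite mem_filter => /andP [].
- by move=> y y' h; apply: colour_local => w wb; rewrite !add0r h.
- by move=> y; exact: colour_lt.
- move=> y yQ yU v v' vv.
  have e x : colour rho Q (fun w => y (x + w)) 0 = colour rho Q y x.
    by apply: colour_local => w _; rewrite add0r.
  rewrite !e; apply: (colour_proper rho_big) => // x w wb w0; apply/eqP.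
  by apply: yU; rewrite mem_filter w0.
- move=> a b w w' u m wb wb'; rewrite mem_filter => /andP [_ ub] m1 e.
  apply: l1norm_sup_ball; have -> : a - b = (w' - w) + m *: u.
    by rewrite -(addrK w a) e addrC -!addrA addKr [- w + _]addrC.
  by apply: sup_ballD; [rewrite mul2n -addnn; apply: sup_ballD => //; exact: sup_ball_opp|exact: sup_ball_line].
Qed.

End Conclusion.

Theorem corollary5 (d : nat) (hd : (2 <= d)%N) :
  exists q k : nat, forall R : realType,
    exists_stationary_dependent_coloring R d 1 q /\
    exists_stationary_dependent_coloring R d k 4.
Proof.
eexists; eexists => R; split; [exact: coloring_1_dependent|exact: coloring_4].
Qed.
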